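(* In dimension $d=1$, the estimate $$\bigg\|\int_{\mathbb{R}}f(x-tv,v)\,dv\bigg\|_{L^2_tL^\infty_x(\mathbb{R}\times\mathbb{R})}\le C\|f\|_{L^{2,1}(\mathbb{R}\times\mathbb{R})}\qquad\text{for all } f\in L^{2,1}(\mathbb{R}\times\mathbb{R})$$ fails, i.e. it does not hold for any finite constant $C$. Hence, the estimate $$\bigg\|\sum_j\lambda_j|e^{it\Delta}f_j|^2\bigg\|_{L^2_tL^\infty_x(\mathbb{R}\times\mathbb{R})}\le C\|\lambda\|_{\ell^{2,1}}$$ for all orthonormal systems $(f_j)_j$ in $L^2(\mathbb{R})$ and all sequences $\lambda=(\lambda_j)_j\in\ell^{2,1}(\mathbb{C})$ is also false, i.e. it does not hold for any finite constant $C$.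
   Context: $e^{it\Delta}$ is the free Schrödinger propagator on $\mathbb{R}$, the Fourier multiplier with symbol $e^{-it|\xi|^2}$. $\|F\|_{L^2_tL^\infty_x}=\big\|\,\|F(\cdot,t)\|_{L^\infty_x}\big\|_{L^2_t}$. With $f^*$ the decreasing rearrangement of $f$ with respect to Lebesgue measure, $\|f\|_{L^{2,1}}=\int_0^\infty\tau^{1/2}f^*(\tau)\frac{d\tau}{\tau}$. With $(\lambda_j^* )_j$ the decreasing permutation of $(|\lambda_j|)_j$, $\|\lambda\|_{\ell^{2,1}}=\sum_{j\ge1}j^{1/2}\lambda_j^*\frac1j$. *)

(* Defs.v *)
From HB Require Import structures.
From mathcomp Require Import all_boot all_order all_algebra.
From mathcomp Require Import all_classical all_reals all_analysis.
From mathcomp Require Import complex.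

Set Implicit Arguments.
Unset Strict Implicit.
Unset Printing Implicit Defensive.

Import Order.TTheory GRing.Theory Num.Theory.
Import numFieldNormedType.Exports.

Local Open Scope classical_set_scope.
Local Open Scope ring_scope.
Local Open Scope complex_scope.

Notation leb := lebesgue_measure.

(* The modulus as a real number (the norm `|z| of R[i] is again an element
   of R[i]). *)
Definition cabs {R : realType} (z : R[i]) : R := ComplexField.Normc.normc z.

Definition cis {R : realType} (theta : R) : R[i] := cos theta +i* sin theta.

Section ComplexValued.
Context {d : measure_display} {T : measurableType d} {R : realType}.
Variable mu : {measure set T -> \bar R}.

Definition cmeasurable (f : T -> R[i]) : Prop :=
  measurable_fun setT (fun x => complex.Re (f x)) /\
  measurable_fun setT (fun x => complex.Im (f x)).

Definition cintegrable (f : T -> R[i]) : Prop :=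
  mu.-integrable setT (fun x => (complex.Re (f x))%:E) /\
  mu.-integrable setT (fun x => (complex.Im (f x))%:E).

Definition cintegral (f : T -> R[i]) : R[i] :=
  (\int[mu]_x complex.Re (f x)) +i* (\int[mu]_x complex.Im (f x)).

Definition Lpnorm (p : \bar R) (f : T -> R[i]) : \bar R :=
  ('N[mu]_p[(fun x => (cabs (f x))%:E)])%E.

Definition inL2 (f : T -> R[i]) : Prop :=
  cmeasurable f /\ (Lpnorm 2%:E f < +oo)%E.

Definition inner (f g : T -> R[i]) : R[i] := cintegral (fun x => f x * (g x)^*).

Definition orthonormal_system (f : nat -> T -> R[i]) : Prop :=
  (forall j, inL2 (f j)) /\ forall j k, inner (f j) (f k) = (j == k)%:R.

(* f^*(tau) = inf { a >= 0 : mu {|f| > a} <= tau }, with inf of the empty set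
   equal to +oo. *)
Definition decreasing_rearrangement (f : T -> R[i]) (tau : R) : \bar R :=
  ereal_inf (EFin @` [set a : R |
    0 <= a /\ (mu [set x | (a < cabs (f x))%R] <= tau%:E)%E]).

Definition lorentz21 (f : T -> R[i]) : \bar R :=
  (\int[leb]_(tau in `]0%R, +oo[)
     ((tau `^ 2^-1)%:E * decreasing_rearrangement f tau * (tau^-1)%:E))%E.

Definition inL21 (f : T -> R[i]) : Prop :=
  cmeasurable f /\ (lorentz21 f < +oo)%E.

End ComplexValued.

Section Estimates.
Context {R : realType}.

(* Here and below the time variable of F comes first. *)
Definition normL2Linfty (F : R -> R -> R[i]) : \bar R :=
  ('N[leb]_2%:E[(fun t => Lpnorm leb +oo (F t))])%E.

(* For f in L^{2,1}(R x R) the integrand is absolutely integrable for almost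
   every (t, x), because 1/|z| is in L^{2,oo}(R^2); the default value 0 on the
   exceptional null set does not affect normL2Linfty. *)
Definition velocity_average (f : R * R -> R[i]) (t x : R) : R[i] :=
  cintegral leb (fun v : R => f (x - t * v, v)).

Definition velocity_average_estimate (C : R) : Prop :=
  forall f : R * R -> R[i],
    inL21 (leb \x leb)%E f ->
    (normL2Linfty (velocity_average f) <= C%:E * lorentz21 (leb \x leb) f)%E.

(* The kernel e^{-i x xi} is the normalization in which Delta has symbol
   -|xi|^2; a constant factor in front of the integral would not change the
   Fourier multipliers. *)
Definition fourier (f : R -> R[i]) (xi : R) : R[i] :=
  cintegral leb (fun x => cis (- (x * xi)) * f x).

(* The graph of the Fourier transform on L^2(R), as the extension by continuity
   from L^1 `&` L^2. *)
Definition is_fourierL2 (f g : R -> R[i]) : Prop :=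
  [/\ inL2 leb f, inL2 leb g &
    exists2 h : nat -> R -> R[i],
      (forall n, cintegrable leb (h n) /\ inL2 leb (h n)) &
      Lpnorm leb 2%:E (fun x => h n x - f x) @[n --> \oo] --> 0%E /\
      Lpnorm leb 2%:E (fun xi => fourier (h n) xi - g xi) @[n --> \oo] --> 0%E].

(* u is a representative of e^{it Delta} f. *)
Definition is_schrodinger (t : R) (f u : R -> R[i]) : Prop :=
  exists2 g : R -> R[i], is_fourierL2 f g &
    is_fourierL2 u (fun xi => cis (- (t * `|xi| ^+ 2)) * g xi).

(* ls is the decreasing permutation of (|lam j|)_j.  The bijection is between
   the indices of the nonzero terms, so that sequences with infinitely many
   nonzero terms are not required to be free of zeros. *)
Definition decreasing_permutation (lam : nat -> R[i]) (ls : nat -> R) : Prop :=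
  [/\ nonincreasing_seq ls, forall j, 0 <= ls j &
    exists2 sigma : nat -> nat,
      set_bij [set j | ls j != 0] [set k | lam k != 0] sigma &
      forall j, ls j != 0 -> ls j = cabs (lam (sigma j))].

(* The l^{2,1} norm in terms of the decreasing permutation, indexed from 0. *)
Definition lorentz21_seq (ls : nat -> R) : \bar R :=
  (\sum_(0 <= j <oo) ((j.+1%:R `^ 2^-1 * ls j / j.+1%:R)%R)%:E)%E.

Definition density_partial_sum (lam : nat -> R[i]) (u : nat -> R -> R -> R[i])
    (t x : R) (n : nat) : R[i] :=
  \sum_(j < n) lam j * ((cabs (u j t x)) ^+ 2)%:C.

(* u j t represents e^{it Delta} (f j), and rho is the sum of the series
   sum_j lam_j |e^{it Delta} f_j|^2; it depends on the representatives only up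
   to null sets in x, for almost every t.  No bound is claimed for systems
   whose series diverges. *)
Definition orthonormal_strichartz_estimate (C : R) : Prop :=
  forall (f : nat -> R -> R[i]) (u : nat -> R -> R -> R[i])
         (lam : nat -> R[i]) (ls : nat -> R) (rho : R -> R -> R[i]),
    orthonormal_system leb f ->
    (forall j t, is_schrodinger t (f j) (u j t)) ->
    decreasing_permutation lam ls ->
    (lorentz21_seq ls < +oo)%E ->
    (\forall t \ae leb, \forall x \ae leb,
       cabs (density_partial_sum lam u t x n - rho t x) @[n --> \oo] --> (0 : R)) ->
    (normL2Linfty rho <= C%:E * lorentz21_seq ls)%E.

End Estimates.

(* Main.v *)
Require Import Defs.
From mathcomp Require Import all_boot all_order all_algebra.
From mathcomp Require Import all_classical all_reals all_analysis.
From mathcomp Require Import measurable_realfun ess_sup_inf complex zify ring lra.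

Set Implicit Arguments.
Unset Strict Implicit.
Unset Printing Implicit Defensive.

Import Order.TTheory GRing.Theory Num.Theory.
Import numFieldNormedType.Exports.

Local Open Scope classical_set_scope.
Local Open Scope ring_scope.
Local Open Scope complex_scope.

(* Both estimates are refuted with one discrete Kakeya set.  Put [M = N ^ N]
   and, for [a < M] with base-[N] digits [a_1 ... a_N] (leading digit first),
   let [X a = sum_j (j / N) a_j N ^ (N - j)].  At height [k / M] in
   [[(j - 1) / N, j / N]] the tube [X a - a k / M] depends, up to an error
   [O(N ^ (N - j))], on the first [j - 1] digits of [a] only.  So the [M] tubes,
   one for each slope [a / M], meet only [O(M / N)] integer points at every
   height, that is [O(M ^ 2 / N)] lattice squares altogether.

   The indicator function of these squares has [L^{2,1}] norm
   [O(M / sqrt N)], while its velocity average is at least [M] near [X a], at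
   each time [t] in [[0, 1[].  For the Schroedinger equation the squares are
   replaced by wave packets: the functions with Fourier transform
   [1_[k, k + 1[ e^{-2 i pi (m + 1/2) xi}] are orthogonal, and for short times
   [e^{it Delta}] keeps them bounded below on the tube
   [|x - 2 pi (m + 1/2) - 2 t (k + 1/2)| <= pi].  The family of the packets
   [(k, m)] in the Kakeya set, with all coefficients equal to [1], has density
   at least [c M] on a set of positive measure for each short time, while the
   [l^{2,1}] norm of the coefficients is [O(M / sqrt N)].

   The required Plancherel theory is that of bounded, compactly supported, almost
   everywhere continuous functions: damping by [e^{-e|x|}] turns Fourier
   inversion into convolution with the Poisson kernel. *)

(** * A discrete Kakeya set *)

Section Kakeya.
Local Open Scope nat_scope.

(** For [a < N ^ N] this is [N] times the offset [X a]: the digit of weight [N ^ (N - j)] survives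
    reduction modulo [N ^ l.+1] for exactly [j] of the values [l < N]. *)
Definition mod_sum (N a : nat) : nat := \sum_(l < N) a %% N ^ l.+1.

(** The base-[N] digits of [p * N ^ r] and of [b] occupy disjoint positions, so adding the two
    residues produces no carry. *)
Lemma modnD_pow N r l p b : 0 < N -> b < N ^ r ->
  (p * N ^ r + b) %% N ^ l = (p * N ^ r) %% N ^ l + b %% N ^ l.
Proof.
move=> N0 br; have [lr|rl] := leqP l r.
  have z : p * N ^ r %% N ^ l = 0.
    by apply/eqP; rewrite -/(dvdn _ _) dvdn_mull // dvdn_exp2l.
  by rewrite -modnDml z.
have e : N ^ l = N ^ (l - r) * N ^ r by rewrite -expnD subnK // ltnW.
have Nr0 : 0 < N ^ r by rewrite expn_gt0 N0.
rewrite e -muln_modl (modn_small (m := b)); last first.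
  by rewrite (leq_trans br) // leq_pmull // expn_gt0 N0.
rewrite -modnDml -muln_modl modn_small //.
have : p %% N ^ (l - r) < N ^ (l - r) by rewrite ltn_mod expn_gt0 N0.
by move: (p %% N ^ (l - r)) (N ^ (l - r)) (N ^ r) br => u v w; nia.
Qed.

Lemma mod_sumD N r p b : 0 < N -> b < N ^ r ->
  mod_sum N (p * N ^ r + b) = mod_sum N (p * N ^ r) + mod_sum N b.
Proof.
by move=> N0 br; rewrite -big_split; apply: eq_bigr => l _; rewrite modnD_pow.
Qed.

Lemma sum_pow_le N r : 1 < N -> \sum_(l < r) N ^ l.+1 <= 2 * N ^ r.
Proof.
move=> N1; elim: r => [|r IH]; first by rewrite big_ord0.
rewrite big_ord_recr /= !expnS; move: IH; move: (\sum_(_ < _) _) (N ^ r) => u v.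
by nia.
Qed.

(** The [N - r] summands with [l >= r] leave [b] unchanged; the others are residues modulo
    [N ^ l.+1] and add up to at most a geometric sum. *)
Lemma mod_sum_bounds N r b : 1 < N -> r < N -> b < N ^ r.+1 ->
  (N - r) * b <= mod_sum N b <= (N - r) * b + 2 * N ^ r.
Proof.
move=> N1 rN br.
have N0 : 0 < N by exact: ltnW.
have -> : mod_sum N b = \sum_(l < r) b %% N ^ l.+1 + (N - r) * b.
  rewrite /mod_sum -(big_mkord xpredT (fun l => b %% N ^ l.+1)).
  rewrite (big_cat_nat _ (n := r)) //=; last exact: ltnW.
  rewrite big_mkord; congr (_ + _).
  rewrite (eq_big_nat _ _ (F2 := fun=> b)) ?sum_nat_const_nat //.
  move=> l /andP[rl _]; rewrite modn_small // (leq_trans br) //.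
  by rewrite leq_exp2l.
rewrite leq_addl addnC leq_add2l /=.
apply: leq_trans (sum_pow_le r N1); apply: leq_sum => l _.
by rewrite ltnW // ltn_mod expn_gt0 N0.
Qed.

End Kakeya.

(** * Tubes and the lattice points near them *)

Section KakeyaReal.
Context {R : realType}.
Implicit Types (N a k : nat) (y : R).

Definition tube_offset N a : R := (mod_sum N a)%:R / N%:R.

Definition tube N a k : R :=
  tube_offset N a - a%:R * k%:R / (N ^ N)%N%:R.

(** Write [a = p * N ^ r.+1 + b] and [t = k * N / N ^ N], which lies in [[j, j + 1]]. Dropping the
    digits [b] changes the tube by [(mod_sum N b - t * b) / N]. As [N - r = j + 1], [mod_sum_bounds]
    puts this between [0] and [(b + 2 N ^ r) / N], which is at most [2 N ^ r] because
    [b <= N ^ r.+1] and [N >= 2]. *)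
Lemma tube_prefix N k a (j := (k * N %/ N ^ N)%N) (r := (N.-1 - j)%N)
    (p := (a %/ N ^ r.+1)%N) :
    (1 < N)%N -> (k < N ^ N)%N ->
  tube N (p * N ^ r.+1) k <= tube N a k <= tube N (p * N ^ r.+1) k + 2 * (N ^ r)%N%:R.
Proof.
move=> N1 kM; have N0 : (0 < N)%N by exact: ltnW.
have M0 : (0 < N ^ N)%N by rewrite expn_gt0 N0.
have jN : (j < N)%N by rewrite ltn_divLR // mulnC ltn_pmul2l.
have rN : (r < N)%N by rewrite /r; lia.
pose b := (a %% N ^ r.+1)%N.
have br : (b < N ^ r.+1)%N by rewrite ltn_mod expn_gt0 N0.
have aE : a = (p * N ^ r.+1 + b)%N by exact: divn_eq.
rewrite {1 2}aE.
have := mod_sum_bounds N1 rN br.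
rewrite (_ : N - r = j.+1)%N; last by rewrite /r; lia.
have k1 : (j * N ^ N <= k * N)%N by exact: leq_trunc_div.
have k2 : (k * N <= j.+1 * N ^ N)%N by rewrite ltnW // ltn_ceil.
rewrite /tube /tube_offset mod_sumD //.
move: (mod_sum N _) (mod_sum N b) => S1 S2 /andP[].
move: (p * _)%N => P.
have {br} : (b <= N * N ^ r)%N by rewrite -expnS ltnW.
move: (N ^ r)%N (N ^ N)%N M0 k1 k2 => Q M M0 k1 k2 bQ S2l S2u.
have [NR MR] : (2 <= N%:R :> R) /\ 0 < M%:R :> R by rewrite ler_nat ltr0n.
have : [/\ j%:R * M%:R <= k%:R * N%:R :> R, k%:R * N%:R <= j.+1%:R * M%:R :> R,
   b%:R <= N%:R * Q%:R :> R, j.+1%:R * b%:R <= S2%:R :> R &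
   S2%:R <= j.+1%:R * b%:R + 2 * Q%:R :> R].
  by rewrite -!natrM -natrD !ler_nat.
rewrite !natrD -[j.+1%:R]natr1.
have : 0 <= Q%:R :> R by [].
have : 0 <= b%:R :> R by [].
move: (j%:R : R) (b%:R : R) (Q%:R : R) (S1%:R : R) (S2%:R : R) (P%:R : R)
  (k%:R : R) (N%:R : R) (M%:R : R) NR MR.
move=> {jN rN N1 kM N0 M0 k1 k2 bQ S2l S2u aE S1 S2 P M}.
move=> j' b' Q' S1 S2 P k' n M N2 M0 b0 Q0 [k1 k2 bQ S2l S2u].
have N0 : 0 < n by lra.
pose t := k' * n / M.
have t1 : j' <= t by rewrite ler_pdivlMr.
have t2 : t <= j' + 1 by rewrite ler_pdivrMr.
have eq x : x * k' / M = t * x / n by rewrite /t; field; lra.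
rewrite !eq -!mulrBl.
apply/andP; split; first by rewrite ler_pM2r ?invr_gt0 //; nra.
rewrite -[X in _ <= _ + X](mulfK (lt0r_neq0 N0)) -mulrDl.
by rewrite ler_pM2r ?invr_gt0 //; nra.
Qed.

(** At height [k] only the leading [j k] digits matter up to an error [O(N ^ r k)]. There are
    [N ^ j k] such prefixes, each needing a window of [O(N ^ r k)] integers, and [j k + r k = N - 1]
    whatever [k] is. *)
Lemma kakeya_lattice N : (1 < N)%N ->
  exists s : nat -> seq int,
    (forall k, (k < N ^ N)%N -> (size (s k) <= 10 * N ^ N.-1)%N /\ uniq (s k)) /\
    forall a k y, (a < N ^ N)%N -> (k < N ^ N)%N -> `|y - tube N a k| <= 3 ->
      Num.floor y \in s k.
Proof.
move=> N1; have N0 : (0 < N)%N by exact: ltnW.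
have M0 : (0 < N ^ N)%N by rewrite expn_gt0 N0.
pose j k := (k * N %/ N ^ N)%N; pose r k := (N.-1 - j k)%N.
(* The window starts at [floor B - 3] to allow for the distance [3] below the tube; above, [2 N ^ r]
   from [tube_prefix], the distance [3] and the rounding fit into [10 N ^ r] since [N ^ r >= 1]. *)
pose s k := [seq Num.floor (tube N (p * N ^ (r k).+1) k) - 3 + i%:Z
  | p <- iota 0 (N ^ j k), i <- iota 0 (10 * N ^ r k)].
exists (fun k => undup (s k)); split=> [k kM|a k y aM kM].
  split; last exact: undup_uniq.
  rewrite (leq_trans (size_undup _)) // size_allpairs !size_iota.
  rewrite mulnCA -expnD subnKC // -ltnS prednK //.
  by rewrite ltn_divLR // mulnC ltn_pmul2l.
have jN : (j k < N)%N by rewrite ltn_divLR // mulnC ltn_pmul2l.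
have := @tube_prefix N k a N1 kM.
rewrite -/(j k) -/(r k); set p := (a %/ _)%N.
have pj : (p < N ^ j k)%N.
  rewrite ltn_divLR ?expn_gt0 ?N0 // -expnD (leq_trans aM) //.
  by rewrite leq_exp2l // /r; lia.
set B := tube N (p * _) k => /andP[Bl Bu]; rewrite ler_distl => /andP[yl yu].
rewrite mem_undup; apply/allpairsP.
have Q1 : (1 <= N ^ r k)%N by rewrite expn_gt0 N0.
have Fl : Num.floor B - 3 <= Num.floor y.
  rewrite floor_ge_int.
  by rewrite intrB; have := floor_le B; lra.
have Fu : Num.floor y < Num.floor B + (10 * N ^ r k)%N%:Z - 3.
  rewrite floor_lt_int.
  have := floorD1_gt B; rewrite intrB !intrD -[_%:Z%:~R]/(_%:R) natrM.
  have : 1 <= (N ^ r k)%N%:R :> R by rewrite ler1n.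
  lra.
exists (p, `|(Num.floor y - (Num.floor B - 3))%R|%N); rewrite !mem_iota /= add0n.
split=> //; first by lia.
by rewrite -/B gez0_abs; lia.
Qed.

End KakeyaReal.

(** * The Kakeya set of cells and the choice of its scale *)

Section KakeyaSet.
Context {R : realType}.

(** Time is the slope and velocity the height: at time [t] the tube with [a = floor (t M)] serves,
    and [X] is its offset. With [k = floor v], replacing [t v] by [a k / M] costs at most [2],
    because [(a + 1)(k + 1) <= a k + 2 M]; together with [x < X + 1] this stays within the tolerance
    [3] of [kakeya_lattice]. *)
Lemma kakeya_set N : (1 < N)%N ->
  exists P : seq (nat * int),
    [/\ uniq P, (size P <= 10 * (N ^ N * N ^ N.-1))%N,
        forall p, p \in P -> (p.1 < N ^ N)%N &
        forall t : R, 0 <= t < 1 -> exists X : R,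
          forall x v : R, X <= x < X + 1 -> 0 <= v < (N ^ N)%N%:R ->
            (Num.truncn v, Num.floor (x - t * v)) \in P].
Proof.
move=> N1; have [s [sP sin]] := @kakeya_lattice R N N1.
set M := (N ^ N)%N in sP sin *.
have M0 : (0 < M)%N by rewrite expn_gt0 (ltnW N1).
have M0R : 0 < M%:R :> R by rewrite ltr0n.
pose P := [seq (k, m) | k <- iota 0 M, m <- s k].
exists P; split.
- apply: allpairs_uniq_dep; first exact: iota_uniq.
    by move=> k; rewrite mem_iota add0n => /sP[].
  by move=> [k m] [k' m'] _ _ [-> ->].
- rewrite size_allpairs_dep sumnE big_map big_seq_cond.
  apply: (@leq_trans (\sum_(k <- iota 0 M) 10 * N ^ N.-1)%N).
    rewrite [leqRHS]big_seq_cond leq_sum // => k.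
    by rewrite mem_iota add0n andbT => /sP[].
  by rewrite big_const_seq count_predT size_iota iter_addn_0 -mulnA (mulnC M).
- by move=> _ /allpairsPdep[k [m [+ _ ->]]]; rewrite mem_iota.
move=> t /andP[t0 t1]; pose a := Num.truncn (t * M%:R).
have /andP[al au] : a%:R <= t * M%:R < a.+1%:R by rewrite truncn_itv ?mulr_ge0.
have aM : (a < M)%N.
  by rewrite -(ltr_nat R) (le_lt_trans al) // -ltr_pdivlMr // divff // gt_eqF.
exists (tube_offset N a) => x v /andP[xl xu] /andP[v0 vM].
pose k := Num.truncn v.
have /andP[kl ku] : k%:R <= v < k.+1%:R by rewrite truncn_itv.
have kM : (k < M)%N by rewrite -(ltr_nat R) (le_lt_trans kl).
apply/allpairsPdep; exists k, (Num.floor (x - t * v)).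
rewrite mem_iota kM; split=> //; apply: (sin a k) => //.
rewrite /tube -/M; set X := tube_offset N a in xl xu *.
have aM1 : a.+1%:R <= M%:R :> R by rewrite ler_nat.
have kM1 : k.+1%:R <= M%:R :> R by rewrite ler_nat.
move: al au kl ku aM1 kM1; rewrite -![_.+1%:R]natr1.
have a0 : 0 <= a%:R :> R by [].
have k0 : 0 <= k%:R :> R by [].
move: (a%:R : R) (k%:R : R) (M%:R : R) M0R a0 k0 {vM} => u w m m0 u0 w0 u1 u2 w1 w2 u3 w3.
have l1 : u * w / m <= t * v.
  by rewrite ler_pdivrMr // mulrAC ler_pM.
have l2 : t * v <= u * w / m + 2.
  rewrite -lerBlDr ler_pdivlMr // mulrBl.
  have : t * m * v <= (u + 1) * (w + 1) by rewrite ler_pM ?mulr_ge0 // ltW.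
  by rewrite mulrAC => h; nra.
by rewrite ler_norml; lra.
Qed.

(** The contradiction shared by both refutations: the left side will bound the right-hand side of
    the estimate, of order [M / sqrt N], and the right side will be a lower bound for the mixed
    norm, of order [M]. *)
Lemma kakeya_gain (C c : R) : 0 < c -> exists2 N : nat, (1 < N)%N &
  `|C| * (2 * Num.sqrt (10 * (N ^ N * N ^ N.-1))%N%:R) < c * (N ^ N)%N%:R.
Proof.
(* After division by [N ^ N.-1] and squaring, the claim becomes [40 * C ^+ 2 < c ^+ 2 * N], that is
   [b < N]. *)
move=> c0; pose b := 40 * (C / c) ^+ 2.
have b0 : 0 <= b by rewrite mulr_ge0 // sqr_ge0.
pose N := (Num.truncn b).+2; exists N => //.
have bN : b < N%:R by rewrite (lt_le_trans (truncnS_gt b)) // ler_nat.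
have -> : (N ^ N)%N = (N * N ^ N.-1)%N by rewrite -expnS.
have Q0 : 0 < (N ^ N.-1)%N%:R :> R by rewrite ltr0n expn_gt0.
have N0 : 0 < N%:R :> R by [].
rewrite !natrM; move: (_%:R) (N%:R) Q0 N0 bN => Q n Q0 n0 bn.
rewrite (_ : 10 * (n * Q * Q) = 10 * n * Q ^+ 2); last by ring.
rewrite sqrtrM ?sqr_ge0 ?mulr_ge0 ?ltW // sqrtr_sqr (gtr0_norm Q0).
have r0 : 0 <= Num.sqrt (10 * n) by exact: sqrtr_ge0.
have r2 : Num.sqrt (10 * n) ^+ 2 = 10 * n by rewrite sqr_sqrtr ?mulr_ge0 ?ltW.
have : (`|C| * 2 * Num.sqrt (10 * n)) ^+ 2 < (c * n) ^+ 2.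
  rewrite !exprMn r2 real_normK ?num_real //.
  have : 40 * C ^+ 2 < c ^+ 2 * n.
    move: bn; rewrite /b expr_div_n mulrA ltr_pdivrMr ?exprn_gt0 //.
    by rewrite [n * _]mulrC.
  by move=> h; rewrite -subr_gt0; nra.
rewrite ltr_pXn2r // ?nnegrE ?mulr_ge0 // ?ltW // => h.
by rewrite !mulrA ltr_pM2r.
Qed.

End KakeyaSet.

(** * Mixed and Lorentz norms *)

Section NonnegativeIntegral.
Context {d : measure_display} {T : measurableType d} {R : realType}.
Variable mu : {measure set T -> \bar R}.
Local Open Scope ereal_scope.

Import HBNNSimple.

(* Unlike [ge0_le_integral], no measurability is required. *)
Lemma le_integral_nonneg (D : set T) (f g : T -> \bar R) :
  (forall x, D x -> 0 <= f x) -> (forall x, D x -> f x <= g x) ->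
  \int[mu]_(x in D) f x <= \int[mu]_(x in D) g x.
Proof.
move=> f0 fg; rewrite !ge0_integralE //; last first.
  by move=> x Dx; exact: le_trans (f0 x Dx) (fg x Dx).
apply: ge_ereal_sup => _ [h /= hf <-].
apply: ereal_sup_ubound; exists h => //= x.
apply: le_trans (hf x) _; rewrite /patch; case: ifPn => // /set_mem.
exact: fg.
Qed.

Lemma ess_sup_ge_on (A : set T) (f : T -> \bar R) (c : \bar R) :
  measurable A -> 0 < mu A -> (forall x, A x -> c <= f x) ->
  c <= ess_sup mu f.
Proof.
move=> mA A0 cf; rewrite leNgt; apply/negP => fc.
have [N [mN N0 subN]] := ess_sup_ge mu f.
have AN : A `<=` N.
  move=> x Ax; apply: subN => /= fx.
  by have := lt_le_trans (le_lt_trans fx fc) (cf x Ax); rewrite ltxx.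
by move: A0; rewrite (subset_measure0 mA mN AN N0) ltxx.
Qed.

Lemma Lpnorm2E (f : T -> R[i]) :
  Lpnorm mu 2%:E f = (\int[mu]_x ((cabs (f x)) ^+ 2)%:E) `^ 2^-1.
Proof.
rewrite /Lpnorm unlock; congr (_ `^ _); apply: eq_integral => x _.
by rewrite abse_EFin poweR_EFin powR_mulrn // real_normK // num_real.
Qed.

End NonnegativeIntegral.

Section MixedNorm.
Context {R : realType}.

Lemma leb_itv_bnd (a b : R) (x y : bool) : a <= b ->
  lebesgue_measure ([set` Interval (BSide x a) (BSide y b)] : set R) = (b - a)%:E.
Proof.
move=> ab; rewrite lebesgue_measure_itv /=; case: ifPn => [_|].
  by rewrite EFinB.
rewrite -leNgt lee_fin => ba.
by rewrite (@le_anti _ R a b) ?subrr // ab ba.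
Qed.

Lemma integral_indic_itv (a b : R) (x y : bool) : a <= b ->
  (\int[leb]_t ((\1_[set` Interval (BSide x a) (BSide y b)] : R -> R) t)%:E = (b - a)%:E)%E.
Proof.
move=> ab; have mI : measurable ([set` Interval (BSide x a) (BSide y b)] : set R).
  exact: measurable_itv.
by rewrite integral_indic // setIT; exact: leb_itv_bnd.
Qed.

(** An interval has positive measure, so the essential supremum of each slice over [[0, t0[] is at
    least [c]. The norm in time is then compared with that of [c] times an indicator by
    [le_integral_nonneg], as nothing is assumed on the measurability of [F]. *)
Lemma normL2Linfty_ge (F : R -> R -> R[i]) (t0 c : R) :
    0 <= t0 -> 0 <= c ->
    (forall t : R, 0 <= t < t0 -> exists a b : R, a < b /\
       forall x : R, a <= x < b -> c <= cabs (F t x)) ->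
  ((c * Num.sqrt t0)%:E <= normL2Linfty F)%E.
Proof.
move=> t00 c0 Fc.
have sup t : 0 <= t < t0 -> (c%:E <= Lpnorm leb +oo (F t))%E.
  (* The [L^oo] norm is an essential supremum guarded by a test that the whole space has positive
     measure. *)
  move=> /Fc[a [b [ab Fab]]]; rewrite /Lpnorm unlock ifT; last first.
    have := lebesgue_measure_itv (`]-oo, +oo[ : interval R).
    by rewrite set_itvNyy /= => ->; rewrite addye // ltry.
  have ab0 : (0 < leb (`[a, b[%classic : set R))%E.
    by rewrite lebesgue_measure_itv /= lte_fin ab -EFinD lte_fin subr_gt0.
  apply: (@ess_sup_ge_on _ (measurableTypeR R) R _ `[a, b[%classic) => //.
  move=> x /=; rewrite in_itv /= => /Fab cF; rewrite lee_fin.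
  exact: le_trans cF (ler_norm _).
rewrite /normL2Linfty unlock.
have -> : (c * Num.sqrt t0)%:E = (((c ^+ 2 * t0)%:E) `^ 2^-1)%E.
  rewrite poweR_EFin powR12_sqrt ?mulr_ge0 ?sqr_ge0 // sqrtrM ?sqr_ge0 //.
  by rewrite sqrtr_sqr ger0_norm.
apply: gt0_ler_poweR; rewrite ?invr_ge0 // ?in_itv /= ?leey ?andbT.
- by rewrite lee_fin mulr_ge0 ?sqr_ge0.
- by apply: integral_ge0 => t _; exact: poweR_ge0.
apply: (@le_trans _ _ (\int[leb]_t ((c ^+ 2)%:E * (\1_(`[0%R, t0[%classic : set R) t)%:E))%E).
  rewrite ge0_integralZl_EFin ?sqr_ge0 //; last exact/measurable_EFinP.
  by rewrite integral_indic_itv // subr0 EFinM.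
apply: le_integral_nonneg => t _.
  by rewrite -EFinM lee_fin mulr_ge0 ?sqr_ge0.
rewrite indicE; case: (boolP (t \in _)) => [|_]; last by rewrite mule0 poweR_ge0.
rewrite inE /= in_itv /= => /sup ct; rewrite mule1.
rewrite -powR_mulrn // -poweR_EFin; apply: gt0_ler_poweR => //.
- by rewrite in_itv /= lee_fin c0 leey.
- by rewrite in_itv /= abse_ge0 leey.
- by rewrite (le_trans ct) // lee_abs.
Qed.

Lemma integral_powR_halfN_itv (a b : R) : 0 < a -> a < b ->
  (\int[leb]_(t in `[a, b]) ((t `^ (2^-1 - 1))%R)%:E
   = (2 * b `^ 2^-1 - 2 * a `^ 2^-1)%:E)%E.
Proof.
move=> a0 ab.
have dF (x : R) : 0 < x ->
    is_derive x 1 (fun t : R => 2 * t `^ 2^-1) (x `^ (2^-1 - 1)).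
  move=> x0; have dx := is_derive1_powR 2^-1 x0.
  have -> : x `^ (2^-1 - 1) = 2 *: (2^-1 * x `^ (2^-1 - 1)).
    by rewrite /GRing.scale /= mulrA divff // mul1r.
  exact: is_deriveZ.
have cF (x : R) : 0 < x -> {for x, continuous (fun t : R => 2 * t `^ 2^-1)}.
  move=> x0; apply/differentiable_continuous/derivable1_diffP.
  by have [] := dF x x0.
rewrite (@continuous_FTC2 _ _ (fun t => 2 * t `^ 2^-1)) //.
- apply: continuous_in_subspaceT => x; rewrite inE /= in_itv /= => /andP[ax _].
  have x0 := lt_le_trans a0 ax.
  apply/differentiable_continuous/derivable1_diffP.
  by have [] := is_derive1_powR (2^-1 - 1) x0.
- split.
  + move=> x; rewrite in_itv /= => /andP[ax _].
    by have [] := dF x (lt_trans a0 ax).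
  + by apply: cvg_at_right_filter; exact: cF.
  + by apply: cvg_at_left_filter; apply: cF; exact: lt_trans ab.
- move=> x; rewrite in_itv /= => /andP[ax _].
  by rewrite derive1E; have [_ ->] := dF x (lt_trans a0 ax).
Qed.

(** The integrand is singular at [0], so the primitive is used on [[m / (n + 2), m]] and the
    intervals exhaust []0, m]] by monotone convergence. The [+ 2] keeps them nondegenerate from
    [n = 0] on. *)
Lemma integral_powR_halfN_le (m : R) :
  (\int[leb]_(t in `]0%R, m]) ((t `^ (2^-1 - 1))%R)%:E <= (2 * Num.sqrt m)%:E)%E.
Proof.
have [m0|m0] := leP m 0.
  by rewrite set_itv_ge ?bnd_simp -?leNgt // integral_set0 lee_fin mulr_ge0 ?sqrtr_ge0.
pose F n : set R := `[m / n.+2%:R, m]%classic.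
have F0 n x : F n x -> 0 < x.
  by rewrite /F /= in_itv /= => /andP[+ _]; apply: lt_le_trans; rewrite divr_gt0.
have -> : `]0, m]%classic = \bigcup_n F n.
  apply/seteqP; split=> x /=; rewrite in_itv /=.
    move=> /andP[x0 xm]; exists (Num.truncn (m / x)) => //=.
    rewrite /F /= in_itv /= xm andbT ler_pdivrMr // mulrC -ler_pdivrMr //.
    apply: le_trans (ltW (truncnS_gt (m / x))) _; first by rewrite ler_nat.
  by move=> [n _ Fx]; rewrite (F0 n) //; move: Fx; rewrite /F /= in_itv /= => /andP[].
have mF n : measurable (F n) by exact: measurable_itv.
have ndF : nondecreasing_seq F.
  move=> i j ij; apply/subsetPset => x; rewrite /F /= !in_itv /= => /andP[ix ->].
  rewrite andbT; apply: le_trans ix; rewrite ler_pM2l // lef_pV2 ?posrE //.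
  by rewrite ler_nat !ltnS.
have mf (i : nat) : measurable_fun (F i) (fun t : R => ((t `^ (2^-1 - 1))%R)%:E).
  by apply/measurable_EFinP; apply: measurable_funTS; exact: measurable_powR.
have f0 i x : F i x -> (0 <= ((x `^ (2^-1 - 1))%R)%:E)%E.
  by move=> _; rewrite lee_fin powR_ge0.
have cv := ge0_nondecreasing_set_cvg_integral (mu := leb) ndF mF mf f0.
rewrite -(cvg_lim _ cv) //; apply: lime_le; first by apply/cvg_ex; eexists; exact: cv.
near=> n; rewrite /F integral_powR_halfN_itv; last 2 first.
- by rewrite divr_gt0.
- by rewrite ltr_pdivrMr // ltr_pMr // ltr1n.
by rewrite -(powR12_sqrt (ltW m0)) lee_fin gerBl mulr_ge0 // powR_ge0.
Unshelve. all: by end_near. Qed.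

Lemma decreasing_rearrangement_ge0 d (T : measurableType d)
    (mu : {measure set T -> \bar R}) (f : T -> R[i]) (t : R) :
  (0 <= decreasing_rearrangement mu f t)%E.
Proof. by apply: le_ereal_inf_tmp => _ /= [a [a0 _] <-]; rewrite lee_fin. Qed.

Lemma lorentz21_ge0 d (T : measurableType d) (mu : {measure set T -> \bar R})
    (f : T -> R[i]) : (0 <= lorentz21 mu f)%E.
Proof.
rewrite /lorentz21; apply: integral_ge0 => t /=; rewrite in_itv /= andbT => t0.
apply: mule_ge0; last by rewrite lee_fin invr_ge0 ltW.
apply: mule_ge0; first by rewrite lee_fin powR_ge0.
exact: decreasing_rearrangement_ge0.
Qed.

(** The level [a = 1] shows that the rearrangement is at most [1], and the level [a = 0] that it
    vanishes for [t > m]. What remains is the integral of [t ^ (-1/2)] over []0, m]]. *)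
Lemma lorentz21_indic_le d (T : measurableType d) (mu : {measure set T -> \bar R})
    (E : set T) (f : T -> R[i]) (m : R) :
  (forall x, cabs (f x) = \1_E x) -> (mu E <= m%:E)%E ->
  (lorentz21 mu f <= (2 * Num.sqrt m)%:E)%E.
Proof.
move=> cabs_indic Em; apply: le_trans (integral_powR_halfN_le m).
rewrite (_ : `]0, m]%classic = `]0, +oo[ `&` `]0, m]); last first.
  apply/seteqP; split=> x /=; rewrite !in_itv /= ?andbT; last by case.
  by move=> /andP[-> ->].
rewrite integral_mkcondr; apply: le_integral_nonneg => t /=; rewrite in_itv /= andbT => t0.
  apply: mule_ge0; last by rewrite lee_fin invr_ge0 ltW.
  apply: mule_ge0; first by rewrite lee_fin powR_ge0.
  exact: decreasing_rearrangement_ge0.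
have inf_le a : 0 <= a -> (mu [set x | (a < cabs (f x))%R] <= t%:E)%E ->
    (decreasing_rearrangement mu f t <= a%:E)%E.
  by move=> a0 mua; apply: ereal_inf_lbound; exists a.
have tE : (t `^ 2^-1)%:E = ((t `^ (2^-1 - 1))%:E * t%:E)%E.
  rewrite -EFinM; congr _%:E.
  by rewrite -{3}(powRr1 (ltW t0)) -powRD ?(gt_eqF t0) ?implybT // subrK.
rewrite tE -!muleA (muleCA t%:E) -EFinM divff ?gt_eqF // mule1.
rewrite patchE; case: ifPn => [tm|].
  rewrite -[X in (_ <= X)%E]mule1; apply: lee_wpmul2l; first by rewrite lee_fin powR_ge0.
  apply: inf_le => //; rewrite (_ : [set x | _] = set0) ?measure0 ?lee_fin ?ltW //.
  apply/seteqP; split=> // x /=; rewrite cabs_indic indicE.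
  by case: (_ \in _); rewrite ?ltxx // ltr10.
rewrite notin_setE /= in_itv /= t0 /= => /negP; rewrite -ltNge => mt.
rewrite (_ : decreasing_rearrangement _ _ _ = 0%E) ?mule0 //.
apply/eqP; rewrite eq_le decreasing_rearrangement_ge0 andbT.
apply: inf_le => //; apply: le_trans (le_trans Em _); last by rewrite lee_fin ltW.
rewrite (_ : [set x | _] = E) //; apply/seteqP; split=> x /=; rewrite cabs_indic indicE.
  by case: (boolP (x \in E)) => [/set_mem//|_]; rewrite ltxx.
by move=> /mem_set ->; rewrite ltr01.
Qed.

End MixedNorm.

(** * Failure for the velocity averages *)

Section ComplexModulus.
Context {R : realType}.
Implicit Types z w : R[i].

Lemma cabsE z : cabs z = Num.sqrt (complex.Re z ^+ 2 + complex.Im z ^+ 2).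
Proof. by case: z. Qed.

Lemma normr_Re_le_cabs z : `|complex.Re z| <= cabs z.
Proof. by rewrite cabsE -sqrtr_sqr ler_wsqrtr // lerDl sqr_ge0. Qed.

Lemma normr_Im_le_cabs z : `|complex.Im z| <= cabs z.
Proof. by rewrite cabsE -sqrtr_sqr ler_wsqrtr // lerDr sqr_ge0. Qed.

Lemma Re_le_cabs z : complex.Re z <= cabs z.
Proof. exact: le_trans (ler_norm _) (normr_Re_le_cabs z). Qed.

Lemma cabs_real (x : R) : cabs x%:C = `|x|.
Proof. by rewrite cabsE /= expr0n /= addr0 sqrtr_sqr. Qed.

End ComplexModulus.

(** * Unions of unit squares *)

Section LatticeSquares.
Context {R : realType}.
Implicit Type P : seq (nat * int).

(** The coordinates are exchanged: an index is a velocity cell followed by a position cell, while a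
    point of the plane is a position followed by a velocity. *)
Definition lattice_squares P : set (R * R) :=
  \big[setU/set0]_(p <- P)
    (`[p.2%:~R, p.2%:~R + 1[%classic `*` `[p.1%:R, p.1%:R + 1[%classic).

Lemma measurable_lattice_squares P : measurable (lattice_squares P).
Proof.
by apply: bigsetU_measurable => p _; apply: measurableX; exact: measurable_itv.
Qed.

Lemma lattice_squares_measure P :
  ((leb \x leb) (lattice_squares P) <= (size P)%:R%:E :> \bar R)%E.
Proof.
elim: P => [|p P IH]; first by rewrite /lattice_squares big_nil measure0.
rewrite /lattice_squares big_cons -/(lattice_squares P).
set Q := _ `*` _.
have mQ : measurable Q by apply: measurableX; exact: measurable_itv.
have := measureU2 (leb \x leb)%E mQ (measurable_lattice_squares P).
move=> /le_trans; apply; rewrite /= -nat1r EFinD leeD // /Q.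
rewrite product_measure1E; [|exact: measurable_itv|exact: measurable_itv].
have leb1 (a : R) : lebesgue_measure (`[a, a + 1[%classic : set R) = 1%E.
  by rewrite leb_itv_bnd ?lerDl // addrAC subrr add0r.
apply: (@le_trans _ _ (1 * 1)%E); last by rewrite mule1.
by rewrite (_ : (_ * _)%E = (1 * 1)%E) //; congr (_ * _)%E; exact: leb1.
Qed.

(** The sign condition is separate because [Num.truncn] sends every negative number to [0]. *)
Lemma lattice_squaresP P (z : R * R) : lattice_squares P z <->
  0 <= z.2 /\ (Num.truncn z.2, Num.floor z.1) \in P.
Proof.
rewrite /lattice_squares -bigcup_seq; split.
  move=> [p /= pP]; rewrite /= !in_itv /= => -[z1 /andP[z2l z2u]].
  have z20 : 0 <= z.2 by exact: le_trans z2l.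
  split=> //; rewrite (@truncn_def _ _ p.1) ?z2l -?natr1 //.
  by rewrite (@floor_def _ _ p.2) -?surjective_pairing // intrD.
move=> [z20 zP]; exists (Num.truncn z.2, Num.floor z.1) => //=.
by rewrite !in_itv /= natr1 truncn_itv // -[1]/(1%:~R) -intrD floor_itv.
Qed.

End LatticeSquares.

Section KineticTransport.
Context {R : realType}.

Lemma velocity_average_estimate_false :
  ~ exists C : R, velocity_average_estimate C.
Proof.
move=> [C HC]; have [N N1] := kakeya_gain C (ltr01 : 0 < 1 :> R).
have [P [_ sizeP ltP kakP]] := @kakeya_set R N N1.
move: sizeP ltP kakP; set M := (N ^ N)%N; set n := (10 * _)%N => sizeP ltP kakP gain.
pose E : set (R * R) := lattice_squares P.
have mE : measurable E by exact: measurable_lattice_squares.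
pose f z : R[i] := (\1_E z : R)%:C.
have lorf : (lorentz21 (leb \x leb) f <= (2 * Num.sqrt n%:R)%:E)%E.
  have fE z : cabs (f z) = \1_E z by rewrite cabs_real ger0_norm.
  have H := @lorentz21_indic_le R _ _ (leb \x leb)%E E f n%:R fE.
  apply: H.
  by apply: le_trans (@lattice_squares_measure R P) _; rewrite lee_fin ler_nat.
have lorf0 := lorentz21_ge0 (leb \x leb)%E f.
have inf : inL21 (leb \x leb)%E f.
  split; last by apply: le_lt_trans lorf _; rewrite ltry.
  split; [exact: measurable_indic|exact: measurable_cst].
have := HC f inf; apply/negP; rewrite -ltNge.
apply: (@le_lt_trans _ _ (`|C| * (2 * Num.sqrt n%:R))%:E).
  apply: (@le_trans _ _ (`|C|%:E * lorentz21 (leb \x leb) f)%E).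
    by apply: lee_wpmul2r => //; rewrite lee_fin ler_norm.
  by rewrite EFinM; apply: lee_wpmul2l; rewrite ?lee_fin.
apply: (@lt_le_trans _ _ (M%:R * Num.sqrt 1)%:E).
  by rewrite sqrtr1 mulr1 lte_fin; rewrite mul1r in gain.
apply: normL2Linfty_ge => // t /kakP[X kakX].
exists X, (X + 1); split; first by rewrite ltrDl.
move=> x xX; apply: le_trans (Re_le_cabs _); rewrite /velocity_average /=.
(* Along this line the indicator of [E] is that of [0 <= v < M]: one inclusion is the Kakeya
   property, the other is the bound [ltP] on the velocity cells. The average is therefore exactly
   [M]. *)
have fvE v : complex.Re (f (x - t * v, v)) = \1_(`[0, M%:R[%classic : set R) v.
  rewrite /f /= !indicE; congr (_%:R); congr (nat_of_bool _).
  apply/idP/idP; rewrite !inE /= in_itv /=.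
    move=> /lattice_squaresP[/= v0 /ltP /= vM]; rewrite v0 /=.
    by apply: lt_le_trans (truncnS_gt v) _; rewrite ler_nat.
  move=> vM; apply/lattice_squaresP => /=; split; first by case/andP: vM.
  exact: kakX.
rewrite [leRHS](_ : _ = M%:R) //.
transitivity (\int[leb]_v (\1_(`[0, M%:R[%classic : set R) v : R)).
  by apply: eq_Rintegral => v _; exact: fvE.
by rewrite /Rintegral integral_indic_itv // subr0.
Qed.

End KineticTransport.

(** * Complex-valued integrals *)

Section ComplexMeasurability.
Context {d : measure_display} {T : measurableType d} {R : realType}.
Implicit Types f g : T -> R[i].

Lemma cmeasurable_cst (c : R[i]) : cmeasurable (fun _ : T => c).
Proof. by split; exact: measurable_cst. Qed.

Lemma cmeasurable_real (h : T -> R) : measurable_fun setT h ->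
  cmeasurable (fun x => (h x)%:C).
Proof. by move=> mh; split=> //; exact: measurable_cst. Qed.

Lemma cmeasurable_cis (h : T -> R) : measurable_fun setT h ->
  cmeasurable (fun x => cis (h x)).
Proof.
move=> mh; split => /=.
  by apply: measurableT_comp mh; apply: continuous_measurable_fun; exact: continuous_cos.
by apply: measurableT_comp mh; apply: continuous_measurable_fun; exact: continuous_sin.
Qed.

Lemma complex_ReM (z w : R[i]) : complex.Re (z * w) =
  complex.Re z * complex.Re w - complex.Im z * complex.Im w.
Proof. by case: z w => [a b] [c e]. Qed.

Lemma complex_ImM (z w : R[i]) : complex.Im (z * w) =
  complex.Re z * complex.Im w + complex.Im z * complex.Re w.
Proof. by case: z w => [a b] [c e]. Qed.

Lemma complex_ReB (z w : R[i]) : complex.Re (z - w) = complex.Re z - complex.Re w.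
Proof. by case: z w => [a b] [c e]. Qed.

Lemma complex_ImB (z w : R[i]) : complex.Im (z - w) = complex.Im z - complex.Im w.
Proof. by case: z w => [a b] [c e]. Qed.

Lemma cmeasurableM f g : cmeasurable f -> cmeasurable g ->
  cmeasurable (fun x => f x * g x).
Proof.
move=> [fr fi] [gr gi]; split.
  rewrite (_ : (fun x => _) = fun x => complex.Re (f x) * complex.Re (g x) -
    complex.Im (f x) * complex.Im (g x)); last by apply/funext => x; rewrite complex_ReM.
  by apply: measurable_funB; exact: measurable_funM.
rewrite (_ : (fun x => _) = fun x => complex.Re (f x) * complex.Im (g x) +
  complex.Im (f x) * complex.Re (g x)); last by apply/funext => x; rewrite complex_ImM.
by apply: measurable_funD; exact: measurable_funM.
Qed.

Lemma cmeasurableB f g : cmeasurable f -> cmeasurable g ->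
  cmeasurable (fun x => f x - g x).
Proof.
move=> [fr fi] [gr gi]; split.
  rewrite (_ : (fun x => _) = fun x => complex.Re (f x) - complex.Re (g x)).
    exact: measurable_funB.
  by apply/funext => x; rewrite complex_ReB.
rewrite (_ : (fun x => _) = fun x => complex.Im (f x) - complex.Im (g x)).
  exact: measurable_funB.
by apply/funext => x; rewrite complex_ImB.
Qed.

Lemma cmeasurable_conj f : cmeasurable f -> cmeasurable (fun x => ((f x)^*)%R).
Proof.
change (cmeasurable f -> cmeasurable (fun x => conjc (f x))); move=> [fr fi]; split.
  by rewrite (_ : (fun x => _) = fun x => complex.Re (f x)) //; apply/funext => x; case: (f x).
rewrite (_ : (fun x => _) = \- (fun x => complex.Im (f x))).
  exact: measurable_funN.
by apply/funext => x /=; case: (f x).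
Qed.

Lemma measurable_cabs f : cmeasurable f -> measurable_fun setT (fun x => cabs (f x)).
Proof.
move=> [fr fi]; under eq_fun do rewrite cabsE.
apply: (measurableT_comp (f := @Num.sqrt R)).
  by apply: continuous_measurable_fun; exact: sqrt_continuous.
by apply: measurable_funD; exact: measurable_funX.
Qed.

End ComplexMeasurability.

Section ModulusAlgebra.
Context {R : realType}.
Implicit Types z w : R[i].

Lemma cabs_ge0 z : 0 <= cabs z.
Proof. by rewrite cabsE sqrtr_ge0. Qed.

Lemma cabsM z w : cabs (z * w) = cabs z * cabs w.
Proof. exact: ComplexField.Normc.normcM. Qed.

Lemma cabsN z : cabs (- z) = cabs z.
Proof. by case: z => a b; rewrite !cabsE /= !sqrrN. Qed.

Lemma cabs_conj z : cabs (z^*)%R = cabs z.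
Proof. by rewrite -[(z^*)%R]/(conjc z); case: z => a b; rewrite !cabsE /= sqrrN. Qed.

Lemma cabs_cis (t : R) : cabs (cis t) = 1.
Proof. by rewrite cabsE /= cos2Dsin2 sqrtr1. Qed.

Lemma cabs0 : cabs (0 : R[i]) = 0.
Proof. by rewrite cabsE /= expr0n /= addr0 sqrtr0. Qed.

Lemma cabs_eq0 z : (cabs z == 0) = (z == 0).
Proof.
apply/eqP/eqP => [|->]; last exact: cabs0.
exact: ComplexField.Normc.eq0_normc.
Qed.

Lemma cabs_le_ReIm z : cabs z <= `|complex.Re z| + `|complex.Im z|.
Proof.
rewrite cabsE -[leRHS]ger0_norm ?addr_ge0 // -sqrtr_sqr ler_wsqrtr //.
rewrite sqrrD !real_normK ?num_real // lerD2r lerDl mulrn_wge0 //.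
Qed.

Lemma ler_cabsD z w : cabs (z + w) <= cabs z + cabs w.
Proof. exact: le_normcD. Qed.

Lemma cisD (s t : R) : cis (s + t) = cis s * cis t.
Proof. by apply/eqP; rewrite eq_complex /= cosD sinD eqxx /= addrC. Qed.

Lemma cis0 : cis (0 : R) = 1.
Proof. by rewrite /cis cos0 sin0. Qed.

Lemma cisN (t : R) : cis (- t) = ((cis t)^*)%R.
Proof. by rewrite -[RHS]/(conjc (cis t)) /cis cosN sinN. Qed.

Lemma mulr_conj z : z * (z^*)%R = (cabs z ^+ 2)%:C.
Proof.
rewrite -[(z^*)%R]/(conjc z); case: z => a b; rewrite cabsE /= sqr_sqrtr ?addr_ge0 ?sqr_ge0 //.
by apply/eqP; rewrite eq_complex /=; apply/andP; split; apply/eqP; ring.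
Qed.

End ModulusAlgebra.

Section ComplexIntegral.
Context {d : measure_display} {T : measurableType d} {R : realType}.
Variable mu : {measure set T -> \bar R}.
Implicit Types f g : T -> R[i].

Lemma cintegrable_le f (h : T -> R) : cmeasurable f ->
  mu.-integrable setT (EFin \o h) -> (forall x, cabs (f x) <= h x) ->
  cintegrable mu f.
Proof.
move=> [fr fi] ih fh.
by split; apply: (le_integrable _ _ _ ih) => //; try exact/measurable_EFinP;
  move=> x _ /=; rewrite lee_fin (le_trans _ (ler_norm _)) // (le_trans _ (fh x)) //;
  rewrite (normr_Re_le_cabs, normr_Im_le_cabs).
Qed.

Lemma cintegrable_cmeasurable f : cintegrable mu f -> cmeasurable f.
Proof.
by move=> [/measurable_int fr /measurable_int fi]; split; exact/measurable_EFinP.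
Qed.

Lemma cintegrable_cabs f : cintegrable mu f ->
  mu.-integrable setT (EFin \o (fun x => cabs (f x))).
Proof.
move=> fint; have mf := cintegrable_cmeasurable fint; have [fr fi] := fint.
have := integrableD measurableT (integrable_norm fr) (integrable_norm fi).
apply: le_integrable => //; first exact/measurable_EFinP/measurable_cabs.
move=> x _ /=; rewrite lee_fin ger0_norm ?cabs_ge0 // ger0_norm ?addr_ge0 //.
exact: cabs_le_ReIm.
Qed.

Lemma cintegralB f g : cintegrable mu f -> cintegrable mu g ->
  cintegral mu (fun x => f x - g x) = cintegral mu f - cintegral mu g.
Proof.
move=> [fr fi] [gr gi]; rewrite /cintegral; apply/eqP; rewrite eq_complex /=.
by apply/andP; split; apply/eqP; rewrite -RintegralB //; apply: eq_Rintegral => x _;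
  rewrite (complex_ReB, complex_ImB).
Qed.

Lemma cintegralZ c f : cintegrable mu f ->
  cintegral mu (fun x => c * f x) = c * cintegral mu f.
Proof.
move=> [fr fi]; have := fun r => integrableZl measurableT r fr.
have := fun r => integrableZl measurableT r fi => iZ rZ.
apply/eqP; rewrite eq_complex complex_ReM complex_ImM /=; apply/andP; split; apply/eqP.
  rewrite -!RintegralZl // -RintegralB //; [|exact: rZ|exact: iZ].
  by apply: eq_Rintegral => x _; rewrite complex_ReM.
rewrite -!RintegralZl // -RintegralD //; [|exact: iZ|exact: rZ].
by apply: eq_Rintegral => x _; rewrite complex_ImM.
Qed.

Lemma cintegral_conj f : cintegrable mu f ->
  cintegral mu (fun x => ((f x)^*)%R) = ((cintegral mu f)^*)%R.
Proof.
change (cintegrable mu f ->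
  cintegral mu (fun x => conjc (f x)) = conjc (cintegral mu f)).
move=> [fr fi]; apply/eqP; rewrite eq_complex /=; apply/andP; split; apply/eqP.
  by apply: eq_Rintegral => x _; case: (f x).
rewrite -[RHS]mulN1r -RintegralZl //.
by apply: eq_Rintegral => x _; rewrite mulN1r; case: (f x).
Qed.

Lemma cintegral_real (h : T -> R) :
  cintegral mu (fun x => (h x)%:C) = (\int[mu]_x h x)%:C.
Proof. by rewrite /cintegral /Rintegral /= integral0. Qed.

Lemma eq_cintegral f g : f =1 g -> cintegral mu f = cintegral mu g.
Proof. by move=> /funext ->. Qed.

(* After multiplication by a unit complex number the integral is nonnegative,
   hence equal to the integral of a real part. *)
Lemma cabs_cintegral_le f : cintegrable mu f ->
  cabs (cintegral mu f) <= \int[mu]_x cabs (f x).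
Proof.
move=> fint; set I := cintegral mu f.
have [->|I0] := eqVneq I 0; first by rewrite cabs0 Rintegral_ge0 // => x _; exact: cabs_ge0.
have aI0 : cabs I != 0 by rewrite cabs_eq0.
pose c : R[i] := ((cabs I)^-1)%:C * (I^*)%R.
have c1 : cabs c = 1 by rewrite cabsM cabs_conj cabs_real ger0_norm ?invr_ge0 ?cabs_ge0 // mulVf.
have cI : c * I = (cabs I)%:C.
  rewrite -mulrA [(_^*)%R * _]mulrC mulr_conj -rmorphM /=; congr (_%:C).
  by rewrite expr2 mulKf.
have cfint : cintegrable mu (fun x => c * f x).
  apply: (cintegrable_le _ (cintegrable_cabs fint)).
    by apply: cmeasurableM; [exact: cmeasurable_cst|exact: cintegrable_cmeasurable].
  by move=> x; rewrite cabsM c1 mul1r.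
have -> : cabs I = complex.Re (cintegral mu (fun x => c * f x)).
  by rewrite cintegralZ // -/I cI.
rewrite /=; apply: le_Rintegral => //; first exact: cfint.1.
  exact: cintegrable_cabs.
by move=> x _; apply: le_trans (Re_le_cabs _) _; rewrite cabsM c1 mul1r.
Qed.

End ComplexIntegral.

(** * Fubini's theorem under a product majorant *)

Section DominatedFubini.
Context {d1 d2 : measure_display} {T1 : measurableType d1} {T2 : measurableType d2}
  {R : realType}.
Variable m1 : {sigma_finite_measure set T1 -> \bar R}.
Variable m2 : {sigma_finite_measure set T2 -> \bar R}.
Variables (a : T1 -> R) (b : T2 -> R).
Hypothesis a0 : forall x, 0 <= a x.
Hypothesis b0 : forall y, 0 <= b y.
Hypothesis ia : m1.-integrable setT (EFin \o a).
Hypothesis ib : m2.-integrable setT (EFin \o b).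

Section Real.
Variable f : T1 * T2 -> R.
Hypothesis mf : measurable_fun setT f.
Hypothesis fab : forall x y, `|f (x, y)| <= a x * b y.

Lemma integrable_prod_le : (m1 \x m2)%E.-integrable setT (EFin \o f).
Proof.
have mEf : measurable_fun setT (EFin \o f) by exact/measurable_EFinP.
apply/(integrable12ltyP _ _ mEf).
have B0 : (0 <= \int[m2]_y (b y)%:E)%E by apply: integral_ge0 => y _; rewrite lee_fin.
have inner x : (\int[m2]_y `|(EFin \o f) (x, y)| <= (a x)%:E * \int[m2]_y (b y)%:E)%E.
  rewrite -ge0_integralZl_EFin //; last 2 first.
  - by move=> y _; rewrite lee_fin.
  - exact: measurable_int ib.
  by apply: le_integral_nonneg => y _; rewrite //= -EFinM lee_fin.
apply: (@le_lt_trans _ _ (\int[m1]_x ((a x)%:E * \int[m2]_y (b y)%:E))%E).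
  by apply: le_integral_nonneg => x _; rewrite ?integral_ge0.
rewrite ge0_integralZr //; last 2 first.
- exact: measurable_int ia.
- by move=> x _; rewrite lee_fin.
apply: lte_mul_pinfty => //.
- by apply: integral_ge0 => x _; rewrite lee_fin.
- exact: integrable_fin_num.
- by have := integrable_fin_num measurableT ib; rewrite fin_numElt => /andP[].
Qed.

Lemma integrable_section1 x : m2.-integrable setT (fun y => (f (x, y))%:E).
Proof.
apply: (le_integrable _ _ _ (integrableZl measurableT (a x) ib)) => //.
  by apply/measurable_EFinP; exact: measurableT_comp.
move=> y _ /=; rewrite lee_fin [leRHS]ger0_norm ?mulr_ge0 //.
Qed.

Lemma integrable_section2 y : m1.-integrable setT (fun x => (f (x, y))%:E).
Proof.
apply: (le_integrable _ _ _ (integrableZl measurableT (b y) ia)) => //.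
  by apply/measurable_EFinP; exact: measurableT_comp.
by move=> x _ /=; rewrite lee_fin [leRHS]ger0_norm ?mulr_ge0 // mulrC.
Qed.

(** The product majorant makes every section integrable, not just almost every one, so the
    real-valued inner integrals coincide everywhere with the extended ones to which Fubini's theorem
    applies. *)
Lemma Rintegral_swap :
  \int[m1]_x \int[m2]_y f (x, y) = \int[m2]_y \int[m1]_x f (x, y).
Proof.
rewrite /Rintegral; congr fine.
transitivity (\int[m1]_x \int[m2]_y (EFin \o f) (x, y))%E.
  apply: eq_integral => x _; rewrite fineK //.
  exact: integrable_fin_num (integrable_section1 x).
rewrite Fubini //; last exact: integrable_prod_le.
apply: eq_integral => y _; rewrite fineK //.
exact: integrable_fin_num (integrable_section2 y).
Qed.

Lemma measurable_Rintegral : measurable_fun setT (fun x => \int[m2]_y f (x, y)).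
Proof.
apply: (measurableT_comp (f := fine)) => //.
exact: measurable_fubini_F integrable_prod_le.
Qed.

End Real.

Variable f : T1 * T2 -> R[i].
Hypothesis mf : cmeasurable f.
Hypothesis fab : forall x y, cabs (f (x, y)) <= a x * b y.

Let fabr x y : `|complex.Re (f (x, y))| <= a x * b y.
Proof. exact: le_trans (normr_Re_le_cabs _) (fab x y). Qed.

Let fabi x y : `|complex.Im (f (x, y))| <= a x * b y.
Proof. exact: le_trans (normr_Im_le_cabs _) (fab x y). Qed.

Lemma cintegral_swap :
  cintegral m1 (fun x => cintegral m2 (fun y => f (x, y))) =
  cintegral m2 (fun y => cintegral m1 (fun x => f (x, y))).
Proof.
case: mf => mr mi; apply/eqP; rewrite eq_complex /=.
by rewrite (Rintegral_swap mr fabr) (Rintegral_swap mi fabi) !eqxx.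
Qed.

Lemma cmeasurable_cintegral : cmeasurable (fun x => cintegral m2 (fun y => f (x, y))).
Proof.
case: mf => mr mi; split=> /=.
  exact: (measurable_Rintegral mr fabr).
exact: (measurable_Rintegral mi fabi).
Qed.

End DominatedFubini.

(** * Dominated convergence for complex-valued functions *)

Section DominatedConvergence.
Context {d : measure_display} {T : measurableType d} {R : realType}.
Variable mu : {measure set T -> \bar R}.

Lemma Lpnorm2_cvg0 (f : nat -> T -> R[i]) (D : T -> R) :
    (forall n, cmeasurable (f n)) ->
    mu.-integrable setT (EFin \o D) ->
    (forall n x, cabs (f n x) ^+ 2 <= D x) ->
    (\forall x \ae mu, cabs (f n x) @[n --> \oo] --> (0 : R)) ->
  Lpnorm mu 2%:E (f n) @[n --> \oo] --> 0%E.
Proof.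
move=> mf iD fD f0.
have := @dominated_convergence _ _ _ mu setT measurableT
  (fun n x => (cabs (f n x) ^+ 2)%:E) (cst 0%E) (EFin \o D).
case.
- by move=> n; apply/measurable_EFinP; apply: measurable_funX; exact: measurable_cabs.
- exact: measurable_cst.
- apply: filterS f0 => x f0 _.
  have : (cabs (f n x) ^+ 2) @[n --> \oo] --> (0 : R).
    rewrite -[X in _ --> X](mulr0 (0 : R)); under eq_fun do rewrite expr2.
    exact: cvgM.
  by move=> c; apply: cvg_EFin => //; exact: nearW.
- by [].
- by apply/aeW => x n _ /=; rewrite lee_fin ger0_norm ?sqr_ge0.
move=> _ _; rewrite integral0 => c0.
pose I n : \bar R := (\int[mu]_x (cabs (f n x) ^+ 2)%:E)%E.
have I0 n : (0 <= I n)%E by apply: integral_ge0 => x _; rewrite lee_fin sqr_ge0.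
have If n : I n \is a fin_num.
  apply: integrable_fin_num => //; apply: (le_integrable _ _ _ iD) => //.
    by apply/measurable_EFinP; apply: measurable_funX; exact: measurable_cabs.
  by move=> x _ /=; rewrite lee_fin ger0_norm ?sqr_ge0 // (le_trans (fD n x)) ?ler_norm.
have LE n : Lpnorm mu 2%:E (f n) = (Num.sqrt (fine (I n)))%:E.
  by rewrite Lpnorm2E -/(I n) -{1}(fineK (If n)) poweR_EFin powR12_sqrt // fine_ge0.
under eq_fun do rewrite LE.
apply: cvg_EFin; first exact: nearW.
have sc : Num.sqrt x @[x --> (0 : R)] --> (0 : R).
  by rewrite -[X in _ --> X](@sqrtr0 R); exact: sqrt_continuous.
exact: (cvg_comp _ _ (fine_cvg c0) sc).
Qed.

Lemma dominated_cintegral_cvg (f : nat -> T -> R[i]) (g : T -> R[i]) (D : T -> R) :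
    (forall n, cmeasurable (f n)) -> cmeasurable g ->
    mu.-integrable setT (EFin \o D) ->
    (forall n x, cabs (f n x) <= D x) -> (forall x, cabs (g x) <= D x) ->
    (\forall x \ae mu, cabs (f n x - g x) @[n --> \oo] --> (0 : R)) ->
  cabs (cintegral mu (f n) - cintegral mu g) @[n --> \oo] --> (0 : R).
Proof.
move=> mf mg iD fD gD fg.
have intf n : cintegrable mu (f n) by exact: cintegrable_le iD (fD n).
have intg : cintegrable mu g by exact: cintegrable_le iD gD.
have mfg n : cmeasurable (fun x => f n x - g x) by exact: cmeasurableB.
have fgD n x : cabs (f n x - g x) <= 2 * D x.
  rewrite (le_trans (ler_cabsD _ _)) // cabsN mulr_natl mulr2n lerD //.
have i2D : mu.-integrable setT (EFin \o (fun x => 2 * D x)).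
  exact: (integrableZl measurableT 2 iD).
have intfg n : cintegrable mu (fun x => f n x - g x) by exact: cintegrable_le i2D (fgD n).
have := @dominated_convergence _ _ _ mu setT measurableT
  (fun n x => (cabs (f n x - g x))%:E) (cst 0%E) (EFin \o (fun x => 2 * D x)).
case.
- by move=> n; apply/measurable_EFinP; exact: measurable_cabs.
- exact: measurable_cst.
- by apply: filterS fg => x c _; apply: cvg_EFin => //; exact: nearW.
- by [].
- by apply/aeW => x n _ /=; rewrite lee_fin ger0_norm ?cabs_ge0.
move=> _ _; rewrite integral0 => /fine_cvg /= c0.
apply: (squeeze_cvgr _ (cvg_cst _) c0).
apply: nearW => n; apply/andP; split; first exact: (cabs_ge0 (cintegral mu (f n) - cintegral mu g)).
change (cabs (cintegral mu (f n) - cintegral mu g) <= \int[mu]_x cabs (f n x - g x)).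
rewrite -cintegralB //.
exact: cabs_cintegral_le.
Qed.

End DominatedConvergence.

(** * The Poisson kernel *)

Section PoissonKernel.
Context {R : realType}.
Implicit Types e s x : R.

Lemma is_derive_mulr (a x : R) : is_derive x 1 (fun y : R => a * y) a.
Proof.
have -> : (fun y : R => a * y) = a \*: id by [].
by apply: is_derive_eq; rewrite /GRing.scale /= mulr1.
Qed.

Lemma ge0_integral_reflect (f : R -> \bar R) :
  measurable_fun setT f -> (forall x, 0 <= f x)%E ->
  (\int[leb]_x f x = \int[leb]_x f (- x)%R)%E.
Proof.
move=> mf f0; transitivity (\int[pushforward leb (-%R : R -> measurableTypeR R)]_x f x)%E.
  by apply: eq_measure_integral => A mA _; exact/esym/lebesgue_measureN.
by rewrite ge0_integral_pushforward.
Qed.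

Lemma ge0_integral_even (f : R -> \bar R) :
  measurable_fun setT f -> (forall x, 0 <= f x)%E -> (forall x, f (- x) = f x) ->
  (\int[leb]_x f x = \int[leb]_(x in `[0%R, +oo[) f x + \int[leb]_(x in `[0%R, +oo[) f x)%E.
Proof.
move=> mf f0 fe.
have U : [set: R] = `]-oo, 0] `|` `]0, +oo[.
  apply/seteqP; split=> // x _ /=; rewrite !in_itv /= andbT.
  by case: (leP x 0); [left|right].
rewrite {1}U ge0_integral_setU //=.
- congr (_ + _)%E.
    rewrite [RHS]ge0_integration_by_substitution0 //.
    by apply: eq_integral => x _; rewrite fe.
  by rewrite integral_itv_obnd_cbnd //; exact: measurable_funTS.
- exact: measurable_funTS.
- apply/disj_setPS => x /=; rewrite !in_itv /= andbT => -[x0 x1].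
  by have := le_lt_trans x0 x1; rewrite ltxx.
Qed.

Lemma expR_mulr_cvg0 e : 0 < e -> expR (- e * x) @[x --> +oo] --> (0 : R).
Proof.
move=> e0; have c : (e * x) @[x --> +oo] --> +oo by apply: gt0_cvgMry.
have := cvg_comp _ _ c (@cvgr_expR R).
by apply: cvg_trans; apply: near_eq_cvg; apply: nearW => x /=; rewrite mulNr.
Qed.

(** The summand [1] makes the integrand nonnegative, as the fundamental theorem of calculus on a
    half-line demands; it is subtracted again in [cintegral_cis_damping]. *)
Lemma integral0y_expR_cos e s : 0 < e ->
  (\int[leb]_(x in `[0%R, +oo[) ((1 + cos (s * x)) * expR (- e * x))%:E
   = (e^-1 + e / (e ^+ 2 + s ^+ 2))%:E)%E.
Proof.
move=> e0; pose D := e ^+ 2 + s ^+ 2.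
have D0 : 0 < D by rewrite ltr_pwDl ?exprn_gt0 ?sqr_ge0.
pose E := expR \o (fun y : R => - e * y).
pose S := sin \o (fun y : R => s * y).
pose K := cos \o (fun y : R => s * y).
(* Every term of this primitive carries the factor [E], so it vanishes at infinity and the integral
   is [- F 0]. *)
pose F := - e^-1 \*: E + D^-1 \*: (E * (s \*: S - e \*: K)).
have dE x : is_derive x 1 E (expR (- e * x) * - e).
  by apply: is_derive1_comp; exact: is_derive_mulr.
have dS x : is_derive x 1 S (cos (s * x) * s).
  by apply: is_derive1_comp; exact: is_derive_mulr.
have dK x : is_derive x 1 K (- sin (s * x) * s).
  by apply: is_derive1_comp; exact: is_derive_mulr.
have dF x : is_derive x 1 F ((1 + cos (s * x)) * expR (- e * x)).
  apply: is_derive_eq; rewrite /E /S /K /D !fctE /= /GRing.scale /=.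
  by field; rewrite -/D !gt_eqF.
have cF : continuous F.
  by move=> x; apply/differentiable_continuous/derivable1_diffP; have [] := dF x.
pose f : R -> R := (cst 1 + K) * E.
have cf : continuous f.
  by move=> x; apply/differentiable_continuous/derivable1_diffP; exact: ex_derive.
rewrite (@ge0_continuous_FTC2y _ f F 0 0).
- rewrite sub0e -EFinN; congr _%:E; rewrite /F /E /S /K !fctE /=.
  rewrite !mulr0 sin0 cos0 expR0 /GRing.scale /= -/D; field.
  by rewrite !gt_eqF.
- move=> x _; rewrite mulr_ge0 ?expR_ge0 // -lerBlDl sub0r.
  exact: cos_geN1.
- apply: continuous_subspaceT; exact: cf.
- pose M := e^-1 + D^-1 * (`|s| + `|e|).
  apply: norm_cvg0.
  have Ec : (M * expR (- e * x)) @[x --> +oo] --> (0 : R).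
    by rewrite -[X in _ --> X](mulr0 M); exact: (cvgM (cvg_cst M) (expR_mulr_cvg0 e0)).
  apply: (squeeze_cvgr _ (cvg_cst _) Ec); apply: nearW => x /=.
  rewrite normr_ge0 /= /F /E /S /K !fctE /= /GRing.scale /=.
  rewrite mulrCA -[X in `|_ + X|]mulrC -mulrDl normrM (ger0_norm (expR_ge0 _)).
  rewrite ler_wpM2r ?expR_ge0 // (le_trans (ler_normD _ _)) // normrN.
  rewrite gtr0_norm ?invr_gt0 // lerD2l normrM gtr0_norm ?invr_gt0 //.
  rewrite ler_wpM2l ?invr_ge0 ?(ltW D0) // (le_trans (ler_normB _ _)) // !normrM.
  by rewrite lerD // ler_piMr // ?sin_max ?cos_max.
- by move=> x _; have [] := dF x.
- by apply: cvg_at_right_filter; exact: cF.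
- by move=> x _; rewrite derive1E; have [_ ->] := dF x.
Qed.

Definition damping e x : R := expR (- e * `|x|).

(** The Poisson kernel of the half-plane times [2 pi]: with this normalization it is the Fourier
    transform of [damping e], and its total mass is [2 pi]. *)
Definition poisson e s : R := 2 * e / (e ^+ 2 + s ^+ 2).

Lemma damping_ge0 e x : 0 <= damping e x.
Proof. exact: expR_ge0. Qed.

Lemma damping_le1 e x : 0 <= e -> damping e x <= 1.
Proof. by move=> e0; rewrite -[leRHS]expR0 ler_expR mulNr oppr_le0 mulr_ge0. Qed.

Lemma measurable_damping e : measurable_fun setT (damping e).
Proof.
apply: measurableT_comp; first exact: measurable_expR.
exact: measurable_funM.
Qed.

Lemma measurable_trig (h : R -> R) s : continuous h ->
  measurable_fun setT (fun x => h (s * x)).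
Proof.
move=> ch; apply: measurableT_comp; first exact: continuous_measurable_fun.
exact: measurable_funM.
Qed.

Lemma integral_cos_damping e s : 0 < e ->
  (\int[leb]_x ((1 + cos (s * x)) * damping e x)%:E = (2 / e + poisson e s)%:E)%E.
Proof.
move=> e0.
have half : (\int[leb]_(x in `[0%R, +oo[) ((1 + cos (s * x)) * damping e x)%:E
   = (e^-1 + e / (e ^+ 2 + s ^+ 2))%:E)%E.
  rewrite -integral0y_expR_cos //; apply: eq_integral => x.
  by rewrite inE /= in_itv /= andbT => x0; rewrite /damping ger0_norm.
rewrite ge0_integral_even.
- rewrite half -EFinD /poisson; congr _%:E; rewrite -!mulrA; ring.
- apply/measurable_EFinP; apply: measurable_funM (measurable_damping e).
  by apply: measurable_funD => //; apply: measurable_trig; exact: continuous_cos.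
- by move=> x; rewrite lee_fin mulr_ge0 ?damping_ge0 // -lerBlDl sub0r cos_geN1.
- by move=> x; rewrite /damping normrN mulrN cosN.
Qed.

(** The case [s = 0] of [integral_cos_damping], whose integrand is [2 * damping e], serves as
    majorant. *)
Lemma integrable_damping e : 0 < e -> leb.-integrable setT (EFin \o damping e).
Proof.
move=> e0; apply: (@le_integrable _ _ _ leb setT measurableT _
    (fun x => ((1 + cos (0 * x)) * damping e x)%:E)).
- by apply/measurable_EFinP; exact: measurable_damping.
- move=> x _ /=; rewrite lee_fin mul0r cos0 normrM ler_peMl //.
  by rewrite ger0_norm ?addr_ge0 // lerDl.
apply/integrableP; split.
  apply/measurable_EFinP; apply: measurable_funM (measurable_damping e).
  by apply: measurable_funD => //; apply: measurable_trig; exact: continuous_cos.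
apply: (@le_lt_trans _ _ (\int[leb]_x ((1 + cos (0 * x)) * damping e x)%:E)%E).
  apply: le_integral_nonneg => x _; rewrite ?abse_ge0 // gee0_abs //.
  by rewrite lee_fin mulr_ge0 ?damping_ge0 // mul0r cos0 addr_ge0.
by rewrite integral_cos_damping // ltry.
Qed.

Lemma cintegrable_cis_damping e s : 0 < e ->
  cintegrable leb (fun x => cis (x * s) * (damping e x)%:C).
Proof.
move=> e0; apply: cintegrable_le (integrable_damping e0) _.
  apply: cmeasurableM; last by apply: cmeasurable_real; exact: measurable_damping.
  by apply: cmeasurable_cis; apply: measurable_funM.
by move=> x; rewrite cabsM cabs_cis mul1r cabs_real ger0_norm ?damping_ge0.
Qed.

Lemma cintegral_cis_damping e s : 0 < e ->
  cintegral leb (fun x => cis (x * s) * (damping e x)%:C) = (poisson e s)%:C.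
Proof.
move=> e0; have [ir ii] := cintegrable_cis_damping s e0.
have ReE x : complex.Re (cis (x * s) * (damping e x)%:C) = cos (s * x) * damping e x.
  by rewrite complex_ReM /= mulr0 subr0 mulrC [s * x]mulrC mulrC.
have ImE x : complex.Im (cis (x * s) * (damping e x)%:C) = sin (s * x) * damping e x.
  by rewrite complex_ImM /= mulr0 add0r [s * x]mulrC.
have idamp := integrable_damping e0.
have icos r : leb.-integrable setT (EFin \o (fun x => cos (r * x) * damping e x)).
  apply: (le_integrable _ _ _ idamp) => //.
    apply/measurable_EFinP; apply: measurable_funM (measurable_damping e).
    by apply: measurable_trig; exact: continuous_cos.
  by move=> x _ /=; rewrite lee_fin normrM ler_piMl // cos_max.
have isin : leb.-integrable setT (EFin \o (fun x => sin (s * x) * damping e x)).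
  by apply: eq_integrable ii => // x _; congr _%:E; exact: ImE.
have cosE r : 1 * \int[leb]_x damping e x + \int[leb]_x (cos (r * x) * damping e x)
    = 2 / e + poisson e r.
  rewrite mul1r -RintegralD // /Rintegral.
  under eq_integral do rewrite -{1}[damping e _]mul1r -mulrDl.
  by rewrite integral_cos_damping.
apply/eqP; rewrite eq_complex /=; apply/andP; split; apply/eqP.
  transitivity (\int[leb]_x (cos (s * x) * damping e x)).
    by apply: eq_Rintegral => x _; exact: ReE.
  (* At frequency [0] the identity [cosE] yields the mass [2 / e] of the damping, which is then
     cancelled from [cosE s]. *)
  have := cosE 0; rewrite (_ : \int[leb]_x (cos (0 * x) * damping e x) =
      \int[leb]_x damping e x); last first.
    by apply: eq_Rintegral => x _; rewrite mul0r cos0 mul1r.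
  have -> : poisson e 0 = 2 / e.
    by rewrite /poisson expr0n /= addr0 expr2 invfM mulrA mulfK ?gt_eqF.
  by move: (cosE s); clear; lra.
transitivity (\int[leb]_x (sin (s * x) * damping e x)).
  by apply: eq_Rintegral => x _; exact: ImE.
(* Reflection is available for nonnegative integrands, so it is applied to [1 + sin], which it
   exchanges with [1 - sin]. The sine integral is thus equal to its opposite. *)
have sgn a : \int[leb]_x ((1 + a * sin (s * x)) * damping e x) =
    \int[leb]_x damping e x + a * \int[leb]_x (sin (s * x) * damping e x).
  rewrite -RintegralZl // -RintegralD //; last exact: (integrableZl measurableT a isin).
  by apply: eq_Rintegral => x _; rewrite mulrDl mul1r mulrA.
have : \int[leb]_x ((1 + 1 * sin (s * x)) * damping e x) =
    \int[leb]_x ((1 + -1 * sin (s * x)) * damping e x).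
  rewrite /Rintegral ge0_integral_reflect.
  - congr fine; apply: eq_integral => x _.
    by rewrite /damping normrN mulrN sinN mul1r mulN1r.
  - apply/measurable_EFinP; apply: measurable_funM (measurable_damping e).
    apply: measurable_funD => //; apply: measurable_funM => //.
    by apply: measurable_trig; exact: continuous_sin.
  - by move=> x; rewrite lee_fin mulr_ge0 ?damping_ge0 // mul1r -lerBlDl sub0r sin_geN1.
by rewrite !sgn; clear; lra.
Qed.

End PoissonKernel.

(** * The Poisson kernel as an approximate identity *)

Section PoissonApproximation.
Context {R : realType}.
Implicit Types e s x : R.

Lemma poisson_ge0 e s : 0 <= e -> 0 <= poisson e s.
Proof. by move=> e0; rewrite divr_ge0 ?addr_ge0 ?sqr_ge0 // mulr_ge0. Qed.

Lemma poissonN e s : poisson e (- s) = poisson e s.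
Proof. by rewrite /poisson sqrrN. Qed.

Lemma continuous_poisson e : 0 < e -> continuous (@poisson R e).
Proof.
move=> e0 x; apply: cvgM; first exact: cvg_cst.
apply: cvgV; first by rewrite gt_eqF // ltr_pwDl ?exprn_gt0 ?sqr_ge0.
by apply: cvgD; [exact: cvg_cst|exact: exprn_continuous].
Qed.

Lemma measurable_poisson e y : 0 < e -> measurable_fun setT (fun x : R => poisson e (x - y)).
Proof.
move=> e0; apply: measurableT_comp.
  by apply: continuous_measurable_fun; exact: continuous_poisson.
exact: measurable_funB.
Qed.

Lemma integral_poisson e y : 0 < e ->
  (\int[leb]_x (poisson e (x - y))%:E = (2 * pi)%:E)%E.
Proof.
move=> e0; pose F x := e^-1 * (x - y).
have dF (x : R) : is_derive x 1 F e^-1.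
  have -> : F = e^-1 \*: (id - cst y) by apply/funext => z.
  by apply: is_derive_eq; rewrite /GRing.scale /= subr0 mulr1.
have F'E : F^`()%classic = cst e^-1 by apply/funext => x; rewrite derive1E; have [_ ->] := dF x.
have Fy : F x @[x --> +oo] --> +oo.
  apply: gt0_cvgMry; first by rewrite invr_gt0.
  exact: cvg_addrr.
have FNy : F x @[x --> -oo] --> -oo.
  apply: gt0_cvgMrNy; first by rewrite invr_gt0.
  exact: cvg_addrr_Ny.
have := @increasing_ge0_integration_by_substitutionT R F (@poisson R 1).
move=> /(_ _ _ _ _ _ FNy Fy) => H.
transitivity (\int[leb]_x (poisson (1 : R) x)%:E)%E.
  rewrite H //.
  - apply: eq_integral => x _; congr _%:E; rewrite F'E /= /poisson /F.
    rewrite !fctE /=; field.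
    by rewrite !gt_eqF // ltr_pwDl ?exprn_gt0 ?sqr_ge0.
  - by move=> a b ab; rewrite ltr_pM2l ?invr_gt0 // ltrD2r.
  - by rewrite F'E; exact: cst_continuous.
  - by rewrite F'E; exact: is_cvg_cst.
  - by rewrite F'E; exact: is_cvg_cst.
  - exact: continuous_poisson.
  - by move=> x; exact: poisson_ge0.
have half : (\int[leb]_(x in `[0%R, +oo[) (poisson (1 : R) x)%:E = pi%:E)%E.
  transitivity (\int[leb]_(x in `[0%R, +oo[) (2%:E * ((oneDsqr (x : R))^-1)%:E))%E.
    by apply: eq_integral => x _; rewrite -EFinM /poisson expr1n mulr1.
  rewrite ge0_integralZl_EFin // ?integral0y_oneDsqr.
  - by rewrite -EFinM mulrC divfK.
  - apply/measurable_EFinP; apply: measurable_funTS.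
    by apply: continuous_measurable_fun; exact: continuous_oneDsqrV.
rewrite ge0_integral_even ?half.
- by rewrite -EFinD mulr_natl mulr2n.
- apply/measurable_EFinP.
  by apply: continuous_measurable_fun; exact: continuous_poisson.
- by move=> x; rewrite lee_fin poisson_ge0.
- by move=> x; rewrite poissonN.
Qed.

Lemma integrable_poisson e y : 0 < e ->
  leb.-integrable setT (EFin \o (fun x : R => poisson e (x - y))).
Proof.
move=> e0; apply/integrableP; split.
  by apply/measurable_EFinP; exact: measurable_poisson.
apply: (@le_lt_trans _ _ (\int[leb]_x (poisson e (x - y))%:E)%E).
  apply: le_integral_nonneg => x _; rewrite ?abse_ge0 // gee0_abs //.
  by rewrite lee_fin poisson_ge0 // ltW.
by rewrite integral_poisson // ltry.
Qed.

(** Since [d <= |s|], one has [1 + s ^+ 2 <= (1 + d ^- 2) * s ^+ 2]. Away from the origin the kernel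
    is therefore [O(e)] times a fixed integrable function. *)
Lemma poisson_far e s (d : R) : 0 < e -> 0 < d -> d <= `|s| ->
  poisson e s <= e * (1 + d ^- 2) * poisson 1 s.
Proof.
move=> e0 d0 ds; have d2 : d ^+ 2 <= s ^+ 2.
  by rewrite -[leRHS]real_normK ?num_real // lerXn2r // nnegrE ?ltW.
have D0 : 0 < d ^+ 2 by rewrite exprn_gt0.
have S0 : 0 < s ^+ 2 by exact: lt_le_trans d2.
have E0 : 0 < e ^+ 2 by rewrite exprn_gt0.
rewrite /poisson expr1n mulr1 ler_pdivrMr ?addr_gt0 //.
rewrite -[leLHS]mul1r !mulrA.
rewrite (_ : e * _ * 2 / _ * _ =
  2 * e * ((1 + d ^- 2) * (e ^+ 2 + s ^+ 2) / (1 + s ^+ 2))); last by ring.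
rewrite mul1r ler_pMr ?mulr_gt0 // ler_pdivlMr ?addr_gt0 // mul1r.
have : d ^- 2 * d ^+ 2 = 1 by rewrite mulVf // gt_eqF.
have : 0 < d ^- 2 by rewrite invr_gt0.
move: (d ^- 2) (d ^+ 2) (e ^+ 2) (s ^+ 2) D0 S0 E0 d2 => u v w z v0 z0 w0 vz u0 uv.
by nra.
Qed.

(** Convolution with [poisson e], not divided by the mass [2 pi]; its limit as [e] tends to [0] is
    [2 pi] times [g]. *)
Definition mollify e (g : R -> R[i]) (y : R) : R[i] :=
  cintegral leb (fun x => g x * (poisson e (x - y))%:C).

Section Mollification.
Variables (g : R -> R[i]) (A B : R).
Hypothesis mg : cmeasurable g.
Hypothesis gB : forall x, cabs (g x) <= B.

Let B0 : 0 <= B.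
Proof. exact: le_trans (cabs_ge0 (g 0)) (gB 0). Qed.

Let integrableZ_poisson (c : R) e y : 0 < e ->
  leb.-integrable setT (EFin \o (fun x : R => c * poisson e (x - y))).
Proof. by move=> e0; exact: (integrableZl measurableT c (integrable_poisson y e0)). Qed.

Let Rintegral_poisson (c : R) e y : 0 < e ->
  \int[leb]_x (c * poisson e ((x : R) - y)) = c * (2 * pi).
Proof.
move=> e0; rewrite RintegralZl //; last exact: integrable_poisson.
by rewrite /Rintegral integral_poisson.
Qed.

Let cmeasurable_mollify (h : R -> R[i]) e y : cmeasurable h -> 0 < e ->
  cmeasurable (fun x => h x * (poisson e (x - y))%:C).
Proof.
move=> mh e0; apply: cmeasurableM => //; apply: cmeasurable_real.
exact: measurable_poisson.
Qed.

Let cintegrable_mollify (h : R -> R[i]) (c : R) e y : cmeasurable h -> 0 < e ->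
  (forall x, cabs (h x) <= c) ->
  cintegrable leb (fun x => h x * (poisson e (x - y))%:C).
Proof.
move=> mh e0 hc; apply: (cintegrable_le _ (integrableZ_poisson c y e0)).
  exact: cmeasurable_mollify.
move=> x; rewrite cabsM cabs_real ger0_norm ?(poisson_ge0 _ (ltW e0)) //.
exact: ler_wpM2r (poisson_ge0 _ (ltW e0)) _ _ (hc x).
Qed.

Lemma mollify_le e y : 0 < e -> cabs (mollify e g y) <= B * (2 * pi).
Proof.
move=> e0; have ig := cintegrable_mollify y mg e0 gB.
apply: le_trans (cabs_cintegral_le ig) _; rewrite -(Rintegral_poisson B y e0).
apply: le_Rintegral => //; first exact: cintegrable_cabs.
  exact: integrableZ_poisson.
move=> x _; rewrite cabsM cabs_real ger0_norm ?(poisson_ge0 _ (ltW e0)) //.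
exact: ler_wpM2r (poisson_ge0 _ (ltW e0)) _ _ (gB x).
Qed.

(** The kernel has mass [2 pi], so the difference is an average of [g x - g y]. This is at most [r]
    for [x] within [d] of [y]; elsewhere it is at most [2 B], and [poisson_far] replaces the kernel
    by a small multiple of [poisson 1]. *)
Lemma mollify_dist_le e y (r d : R) : 0 < e -> 0 < d ->
  (forall x, `|x - y| < d -> cabs (g x - g y) <= r) ->
  cabs (mollify e g y - (2 * pi)%:C * g y)
    <= r * (2 * pi) + 2 * B * (e * (1 + d ^- 2)) * (2 * pi).
Proof.
move=> e0 d0 gr.
have r0 : 0 <= r by apply: le_trans (cabs_ge0 _) (gr y _); rewrite subrr normr0.
have mc : cmeasurable (fun _ : R => g y) by exact: cmeasurable_cst.
have ig := cintegrable_mollify y mg e0 gB.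
have ic := cintegrable_mollify y mc e0 (fun=> gB y).
have -> : (2 * pi)%:C * g y = cintegral leb (fun x => g y * (poisson e (x - y))%:C).
  rewrite cintegralZ; last first.
    apply: cintegrable_le (integrable_poisson y e0) _.
      by apply: cmeasurable_real; exact: measurable_poisson.
    by move=> x; rewrite cabs_real ger0_norm ?(poisson_ge0 _ (ltW e0)).
  by rewrite cintegral_real /Rintegral integral_poisson // mulrC.
rewrite /mollify -cintegralB //.
set c2 := 2 * B * _.
pose h x := r * poisson e (x - y) + c2 * poisson 1 (x - y).
have ih : leb.-integrable setT (EFin \o h).
  exact: (integrableD measurableT (integrableZ_poisson r y e0) (integrableZ_poisson c2 y ltr01)).
have le_h x : cabs (g x * (poisson e (x - y))%:C - g y * (poisson e (x - y))%:C) <= h x.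
  have p0 := poisson_ge0 (x - y) (ltW e0).
  have p1 := poisson_ge0 (x - y) (@ler01 R).
  have c20 : 0 <= c2 by rewrite !mulr_ge0 ?addr_ge0 ?invr_ge0 ?sqr_ge0 // ltW.
  rewrite -mulrBl cabsM cabs_real ger0_norm // /h.
  have [near|far] := ltP `|x - y| d.
    rewrite -[leLHS]addr0 lerD //; last by rewrite mulr_ge0.
    by rewrite ler_wpM2r // gr.
  rewrite -[leLHS]add0r lerD //; first by rewrite mulr_ge0.
  rewrite /c2 -mulrA ler_pM ?cabs_ge0 //; last exact: poisson_far.
  by rewrite (le_trans (ler_cabsD _ _)) // cabsN mulr_natl mulr2n lerD.
have idiff : cintegrable leb
    (fun x => g x * (poisson e (x - y))%:C - g y * (poisson e (x - y))%:C).
  by apply: (cintegrable_le _ ih le_h); apply: cmeasurableB; exact: cmeasurable_mollify.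
apply: le_trans (cabs_cintegral_le idiff) _.
rewrite -(Rintegral_poisson r y e0) -(Rintegral_poisson c2 y ltr01) -RintegralD //;
  try exact: integrableZ_poisson.
by apply: le_Rintegral => //; exact: cintegrable_cabs.
Qed.

End Mollification.

End PoissonApproximation.

(** * Mollification of bounded, compactly supported functions *)

Section Amplitude.
Context {R : realType}.
Implicit Types (g : R -> R[i]) (A B : R).

(** Continuity is demanded only almost everywhere so that the sharp frequency cutoffs of the wave
    packets qualify. It gives almost everywhere convergence of the mollifications by an elementary
    argument. *)
Definition amplitude A B g : Prop :=
  [/\ cmeasurable g, forall x, cabs (g x) <= B,
      forall x, A < `|x| -> g x = 0 &
      \forall x \ae lebesgue_measure, forall r, 0 < r ->
        exists2 d, 0 < d & forall y, `|y - x| < d -> cabs (g y - g x) <= r].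

Lemma amplitude_integrable A B g : amplitude A B g -> cintegrable leb g.
Proof.
move=> [mg gB gA _].
have ih : leb.-integrable setT (EFin \o (fun x : R => B * \1_(`[- A, A]%classic) x)).
  exact: (integrableZl measurableT B (integrable_indic_itv _ _ _ _)).
apply: (cintegrable_le _ ih); first exact: mg.
move=> x; rewrite indicE; case: (boolP (x \in _)) => [_|]; first by rewrite mulr1.
rewrite notin_setE /= in_itv /= -ler_norml => /negP; rewrite -ltNge => /gA ->.
by rewrite cabs0 mulr0.
Qed.

Lemma mollify_cvg A B g (y : R) : amplitude A B g ->
  (forall r, 0 < r -> exists2 d, 0 < d & forall x, `|x - y| < d -> cabs (g x - g y) <= r) ->
  cabs (mollify (harmonic n) g y - (2 * pi)%:C * g y) @[n --> \oo] --> (0 : R).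
Proof.
move=> [mg gB _ _] cg; apply/cvgrPdist_le => eps eps0.
have p0 : 0 < 4 * pi :> R by rewrite mulr_gt0 // pi_gt0.
(* With this radius the near part in [mollify_dist_le] is [eps / (4 * pi) * (2 * pi) = eps / 2]; the
   far part is a constant times [harmonic n]. *)
have [d d0 gd] := cg (eps / (4 * pi)) (divr_gt0 eps0 p0).
pose K := 2 * B * (1 + d ^- 2) * (2 * pi).
have : (K * harmonic n) @[n --> \oo] --> (0 : R).
  by rewrite -[X in _ --> X](mulr0 K); exact: (cvgM (cvg_cst K) (@cvg_harmonic R)).
move=> /cvgrPdist_le /(_ (eps / 2) (divr_gt0 eps0 (ltr0n _ 2))) H.
near=> n; rewrite sub0r normrN ger0_norm ?cabs_ge0 //.
have h0 : 0 < harmonic n :> R by rewrite /harmonic /= invr_gt0 ltr0n.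
apply: (le_trans (mollify_dist_le mg gB h0 d0 gd)).
have Kn : K * harmonic n <= eps / 2.
  apply: (@le_trans _ _ `|0 - K * harmonic n|); last by near: n.
  by rewrite sub0r normrN ler_norm.
rewrite (_ : 2 * B * _ * _ = K * harmonic n); last by rewrite /K; ring.
rewrite (_ : eps / (4 * pi) * (2 * pi) = eps / 2); last first.
  by move: (pi : R) (pi_gt0 R) => p pi0; field; rewrite gt_eqF.
by rewrite [leRHS](splitr eps) lerD2l.
Unshelve. all: by end_near. Qed.

(** For [x] in the support, [|x - y|] is at least [|y| / 2] and at least [1/2]. Then [poisson_far]
    with [d = 1/2] gives the factor [5], and comparing [poisson 1 (x - y)] with [poisson 1 y] the
    factor [4]. *)
Lemma mollify_far A B g e (y : R) : amplitude A B g -> 0 < e <= 1 -> 2 * A + 1 < `|y| ->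
  cabs (mollify e g y) <= 20 * (\int[leb]_x cabs (g x)) * poisson 1 y.
Proof.
move=> ag /andP[e0 e1] yA; have [mg gB gA _] := ag.
have ig := amplitude_integrable ag.
have p1 := poisson_ge0 y (@ler01 R).
have le_p x : cabs (g x * (poisson e (x - y))%:C) <= 20 * poisson 1 y * cabs (g x).
  rewrite cabsM cabs_real ger0_norm ?(poisson_ge0 _ (ltW e0)) //.
  have [xA|Ax] := leP `|x| A; last by rewrite gA // cabs0 mul0r mulr0.
  rewrite mulrC; apply: ler_wpM2r; first exact: cabs_ge0.
  have xy : `|y| / 2 <= `|x - y|.
    have := ler_normB x (x - y); rewrite opprB addrCA subrr addr0.
    lra.
  have d2 : 2^-1 <= `|x - y| :> R by have := normr_ge0 x; lra.
  apply: le_trans (poisson_far e0 _ d2) _ => //.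
  rewrite (_ : 1 + _ = 5); last by field.
  have : poisson 1 (x - y) <= 4 * poisson 1 y.
    rewrite /poisson expr1n mulr1 mulrA ler_pdivrMr ?ltr_pwDl ?sqr_ge0 //.
    rewrite mulrAC ler_pdivlMr ?ltr_pwDl ?sqr_ge0 //.
    have : (`|y| / 2) ^+ 2 <= `|x - y| ^+ 2 by rewrite lerXn2r // nnegrE divr_ge0.
    by rewrite real_normK ?num_real // expr_div_n real_normK ?num_real //; nra.
  have := poisson_ge0 (x - y) (@ler01 R).
  by move: p1 e0 e1; clear; nra.
apply: le_trans (cabs_cintegral_le _) _.
  apply: (cintegrable_le _ (integrableZl measurableT (20 * poisson 1 y) (cintegrable_cabs ig)) le_p).
  by apply: cmeasurableM => //; apply: cmeasurable_real; exact: measurable_poisson.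
rewrite mulrAC -RintegralZl //; last exact: cintegrable_cabs.
apply: le_Rintegral => //.
- apply: cintegrable_cabs.
  apply: (cintegrable_le _ (integrableZl measurableT (20 * poisson 1 y) (cintegrable_cabs ig)) le_p).
  by apply: cmeasurableM => //; apply: cmeasurable_real; exact: measurable_poisson.
- exact: (integrableZl measurableT (20 * poisson 1 y) (cintegrable_cabs ig)).
Qed.

(** An integrable majorant, uniform in [e], for dominated convergence in [L^2]. For [|y| <= 2 A + 1]
    the uniform bound suffices, as [poisson 1 y] is bounded below there; beyond, [mollify_far] is
    squared and one of the two factors [poisson 1 y] is bounded by [2]. *)
Lemma mollify_dominated A B g : amplitude A B g -> exists2 c : R, 0 <= c &
  forall e y, 0 < e <= 1 -> cabs (mollify e g y) ^+ 2 <= c * poisson 1 y.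
Proof.
move=> ag; have [mg gB gA _] := ag.
have B0 : 0 <= B := le_trans (cabs_ge0 (g 0)) (gB 0).
pose G : R := \int[leb]_x cabs (g x).
have G0 : 0 <= G by apply: Rintegral_ge0 => x _; exact: cabs_ge0.
pose c1 := (B * (2 * pi)) ^+ 2 * (1 + (2 * A + 1) ^+ 2).
pose c2 := 2 * (20 * G) ^+ 2.
have c10 : 0 <= c1 by rewrite mulr_ge0 ?sqr_ge0 // addr_ge0 ?sqr_ge0.
have c20 : 0 <= c2 by rewrite mulr_ge0 ?sqr_ge0.
exists (c1 + c2); first exact: addr_ge0.
move=> e y /andP[e0 e1]; rewrite mulrDl.
have p1 := poisson_ge0 y (@ler01 R).
have [yA|yA] := leP `|y| (2 * A + 1).
  apply: (@le_trans _ _ (c1 * poisson 1 y)); last by rewrite lerDl mulr_ge0.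
  apply: (@le_trans _ _ ((B * (2 * pi)) ^+ 2)).
    by rewrite lerXn2r ?nnegrE ?cabs_ge0 ?mulr_ge0 ?pi_ge0 // mollify_le.
  rewrite /c1 -mulrA ler_peMr ?sqr_ge0 // /poisson expr1n mulr1 mulrA.
  rewrite ler_pdivlMr ?ltr_pwDl ?sqr_ge0 // mul1r.
  have : `|y| ^+ 2 <= (2 * A + 1) ^+ 2 by rewrite lerXn2r // nnegrE (le_trans _ yA).
  rewrite real_normK ?num_real //.
  by have := sqr_ge0 y; have := sqr_ge0 (2 * A + 1); lra.
apply: (@le_trans _ _ (c2 * poisson 1 y)); last by rewrite lerDr mulr_ge0.
apply: (@le_trans _ _ ((20 * G * poisson 1 y) ^+ 2)).
  have mf : cabs (mollify e g y) <= 20 * G * poisson 1 y.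
    by apply: (mollify_far ag _ yA); rewrite e0.
  rewrite lerXn2r ?nnegrE //; first exact: cabs_ge0.
  by apply: mulr_ge0 p1; apply: mulr_ge0 G0.
rewrite exprMn expr2 mulrA /c2 [2 * _]mulrC ler_wpM2r // ler_wpM2l ?sqr_ge0 //.
by rewrite /poisson expr1n mulr1 ler_pdivrMr ?ltr_pwDl ?sqr_ge0 // ler_pMr // lerDl sqr_ge0.
Qed.

End Amplitude.

(** * Inverse Fourier transforms of amplitudes *)

Section Plancherel.
Context {R : realType}.
Implicit Types (g h : R -> R[i]) (A B e x y : R).

(** The multiplication formula for a unimodular kernel: Fubini applies with the majorant
    [cabs (h x) * cabs (g y)]. It is used with [k] an exponential of [x * y] or of [- (x * y)]. *)
Lemma kernel_swap g h (k : R * R -> R[i]) :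
  cintegrable leb g -> cintegrable leb h -> cmeasurable k ->
  (forall z, cabs (k z) = 1) ->
  cintegral leb (fun x => h x * cintegral leb (fun y => k (x, y) * g y)) =
  cintegral leb (fun y => g y * cintegral leb (fun x => k (x, y) * h x)).
Proof.
move=> ig ih mk k1.
have mg := cintegrable_cmeasurable ig; have mh := cintegrable_cmeasurable ih.
pose F (z : R * R) := h z.1 * (k z * g z.2).
have mF : cmeasurable F.
  apply: cmeasurableM.
    by case: mh => hr hi; split; [apply: measurableT_comp hr _|apply: measurableT_comp hi _];
      exact: measurable_fst.
  apply: cmeasurableM => //.
  by case: mg => gr gi; split; [apply: measurableT_comp gr _|apply: measurableT_comp gi _];
    exact: measurable_snd.
have Fle x y : cabs (F (x, y)) <= cabs (h x) * cabs (g y).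
  by rewrite /F /= !cabsM k1 mul1r.
have mk1 x : cmeasurable (fun y => k (x, y)).
  by case: mk => kr ki; split; [exact: (measurable_fun_pair2 x kr)|exact: (measurable_fun_pair2 x ki)].
have mk2 y : cmeasurable (fun x => k (x, y)).
  by case: mk => kr ki; split; [exact: (measurable_fun_pair1 y kr)|exact: (measurable_fun_pair1 y ki)].
transitivity (cintegral leb (fun x => cintegral leb (fun y => F (x, y)))).
  apply: eq_cintegral => x; rewrite -cintegralZ //.
  apply: (cintegrable_le _ (cintegrable_cabs ig)).
    by apply: cmeasurableM => //; exact: mk1.
  by move=> y; rewrite cabsM k1 mul1r.
rewrite (@cintegral_swap _ _ _ _ _ leb leb (fun x => cabs (h x)) (fun y => cabs (g y))) //.
- apply: eq_cintegral => y; rewrite -cintegralZ.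
    by apply: eq_cintegral => x; rewrite /F /=; ring.
  apply: (cintegrable_le _ (cintegrable_cabs ih)).
    by apply: cmeasurableM => //; exact: mk2.
  by move=> x; rewrite cabsM k1 mul1r.
- by move=> x; exact: cabs_ge0.
- by move=> x; exact: cabs_ge0.
- exact: cintegrable_cabs.
- exact: cintegrable_cabs.
Qed.

(** Unnormalized: the factor [1 / (2 pi)] of the inverse transform is supplied where needed, as in
    [packet]. *)
Definition inverse_fourier g x : R[i] := cintegral leb (fun xi => cis (x * xi) * g xi).

Lemma cmeasurable_cis_prod (s : R) : cmeasurable (fun z : R * R => cis (s * (z.1 * z.2))).
Proof.
apply: cmeasurable_cis; apply: measurable_funM => //.
by apply: measurable_funM; [exact: measurable_fst|exact: measurable_snd].
Qed.

Lemma cintegrable_cis g (h : R -> R) : measurable_fun setT h -> cintegrable leb g ->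
  cintegrable leb (fun xi => cis (h xi) * g xi).
Proof.
move=> mh ig; apply: (cintegrable_le _ (cintegrable_cabs ig)).
  apply: cmeasurableM; first exact: cmeasurable_cis.
  exact: cintegrable_cmeasurable ig.
by move=> xi; rewrite cabsM cabs_cis mul1r.
Qed.

Lemma cabs_inverse_fourier_le g x : cintegrable leb g ->
  cabs (inverse_fourier g x) <= \int[leb]_xi cabs (g xi).
Proof.
move=> ig; have ic : cintegrable leb (fun xi => cis (x * xi) * g xi).
  by apply: cintegrable_cis => //; apply: measurable_funM.
apply: le_trans (cabs_cintegral_le ic) _.
rewrite le_eqVlt; apply/orP; left; apply/eqP; apply: eq_Rintegral => xi _.
by rewrite cabsM cabs_cis mul1r.
Qed.

(** Measurability of a parametric integral comes here from Fubini, which needs integrability in [x]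
    as well. The factor [e^{-|x|}] provides it and is undone by multiplying with [e^{|x|}]. *)
Lemma cmeasurable_inverse_fourier g : cintegrable leb g ->
  cmeasurable (inverse_fourier g).
Proof.
move=> ig; have mg := cintegrable_cmeasurable ig.
pose F (z : R * R) := (damping 1 z.1)%:C * (cis (1 * (z.1 * z.2)) * g z.2).
have mF : cmeasurable F.
  apply: cmeasurableM.
    apply: cmeasurable_real; apply: measurableT_comp measurable_fst.
    exact: measurable_damping.
  apply: cmeasurableM; first exact: cmeasurable_cis_prod.
  by case: mg => gr gi; split; [apply: measurableT_comp gr _|apply: measurableT_comp gi _];
    exact: measurable_snd.
have Fle x y : cabs (F (x, y)) <= damping 1 x * cabs (g y).
  by rewrite /F /= !cabsM cabs_cis mul1r cabs_real ger0_norm ?damping_ge0.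
have := @cmeasurable_cintegral _ _ _ _ _ leb leb (damping 1) (fun y => cabs (g y))
  (damping_ge0 1) (fun y => cabs_ge0 (g y)) (integrable_damping ltr01)
  (cintegrable_cabs ig) F mF Fle.
move=> mFI.
have -> : inverse_fourier g = (fun x => (expR `|x|)%:C * cintegral leb (fun y => F (x, y))).
  apply/funext => x; rewrite /F /= cintegralZ; last first.
    by apply: cintegrable_cis => //; apply: measurable_funM => //; apply: measurable_funM.
  rewrite mulrA -rmorphM /= /damping mulN1r -expRD subrr expR0 mul1r.
  by apply: eq_cintegral => y; rewrite mul1r.
apply: cmeasurableM mFI; apply: cmeasurable_real.
by apply: measurableT_comp; [exact: measurable_expR|exact: normr_measurable].
Qed.

Lemma cintegrable_damped_inverse_fourier g e : 0 < e -> cintegrable leb g ->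
  cintegrable leb (fun x => (damping e x)%:C * inverse_fourier g x).
Proof.
move=> e0 ig; set G := \int[leb]_xi cabs (g xi).
apply: (cintegrable_le _ (integrableZl measurableT G (integrable_damping e0))).
  apply: cmeasurableM; last exact: cmeasurable_inverse_fourier.
  by apply: cmeasurable_real; exact: measurable_damping.
move=> x; rewrite cabsM cabs_real ger0_norm ?damping_ge0 // mulrC.
apply: ler_wpM2r; first exact: damping_ge0.
exact: cabs_inverse_fourier_le.
Qed.

(** After exchanging the integrals, the inner one is that of [cis (x * (xi - y))] against the
    damping, which is the Poisson kernel. *)
Lemma fourier_damped g e y : 0 < e -> cintegrable leb g ->
  fourier (fun x => (damping e x)%:C * inverse_fourier g x) y = mollify e g y.
Proof.
move=> e0 ig.
pose w x : R[i] := cis (x * (- y)) * (damping e x)%:C.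
have iw : cintegrable leb w by exact: cintegrable_cis_damping.
transitivity (cintegral leb (fun x => w x *
    cintegral leb (fun xi => cis (1 * ((x, xi).1 * (x, xi).2)) * g xi))).
  apply: eq_cintegral => x; rewrite mulrA -mulrN /inverse_fourier.
  by congr (_ * _); apply: eq_cintegral => xi; rewrite /= mul1r.
rewrite (kernel_swap ig iw (cmeasurable_cis_prod 1)); last by move=> z; exact: cabs_cis.
apply: eq_cintegral => xi; congr (_ * _); rewrite -cintegral_cis_damping //.
apply: eq_cintegral => x; rewrite /w /= mulrA -cisD; congr (cis _ * _).
by rewrite mul1r mulrBr mulrN.
Qed.

(** A damped Parseval identity: the conjugate of the second transform is written as an integral, and
    exchanging the integrals leaves the Fourier transform of the damped first one. *)
Lemma damped_pairing g1 g2 e : 0 < e -> cintegrable leb g1 -> cintegrable leb g2 ->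
  cintegral leb (fun x => (damping e x)%:C * (inverse_fourier g1 x * ((inverse_fourier g2 x)^*)%R)) =
  cintegral leb (fun y => ((g2 y)^*)%R * mollify e g1 y).
Proof.
move=> e0 i1 i2; have m2 := cintegrable_cmeasurable i2.
have ic2 : cintegrable leb (fun y => ((g2 y)^*)%R).
  apply: (cintegrable_le _ (cintegrable_cabs i2)); first exact: cmeasurable_conj.
  by move=> y; rewrite cabs_conj.
have iF := cintegrable_damped_inverse_fourier e0 i1.
transitivity (cintegral leb (fun x => (damping e x)%:C * inverse_fourier g1 x *
    cintegral leb (fun y => cis (-1 * ((x, y).1 * (x, y).2)) * ((g2 y)^*)%R))).
  apply: eq_cintegral => x; rewrite mulrA; congr (_ * _).
  rewrite /inverse_fourier -cintegral_conj; last first.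
    by apply: cintegrable_cis => //; apply: measurable_funM.
  by apply: eq_cintegral => y; rewrite rmorphM /= -cisN mulN1r.
rewrite (kernel_swap ic2 iF (cmeasurable_cis_prod (-1))); last by move=> z; exact: cabs_cis.
apply: eq_cintegral => y; congr (_ * _); rewrite -(fourier_damped y e0 i1).
by apply: eq_cintegral => x; rewrite /= mulN1r.
Qed.

End Plancherel.

(** * Parseval's identity and Fourier inversion in [L^2] *)

Section InverseFourierL2.
Context {R : realType}.
Implicit Types (g h : R -> R[i]) (A B e x y : R).

Lemma harmonic_gt0 n : 0 < harmonic n :> R.
Proof. by rewrite /harmonic /= invr_gt0 ltr0n. Qed.

Lemma harmonic_le1 n : harmonic n <= 1 :> R.
Proof. by rewrite /harmonic /= invf_le1 ?ltr0n // ler1n. Qed.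

Lemma damping_cvg1 x : damping (harmonic n) x @[n --> \oo] --> (1 : R).
Proof.
have c : (- harmonic n * `|x|) @[n --> \oo] --> (0 : R).
  rewrite -(mul0r `|x|) -oppr0; apply: cvgM; last exact: cvg_cst.
  by apply: cvgN; exact: cvg_harmonic.
rewrite -(@expR0 R).
exact: (cvg_comp _ _ c (@continuous_expR R 0)).
Qed.

Lemma cabs_damping_sub e x (z : R[i]) :
  cabs ((damping e x)%:C * z - z) = `|damping e x - 1| * cabs z.
Proof. by rewrite -{2}[z]mul1r -mulrBl cabsM -cabs_real rmorphB. Qed.

Lemma fourierE h y : fourier h y = inverse_fourier h (- y).
Proof. by apply: eq_cintegral => x; rewrite mulNr mulrC [x * y]mulrC mulrC. Qed.

Lemma cmeasurable_fourier h : cintegrable leb h -> cmeasurable (fourier h).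
Proof.
move=> /cmeasurable_inverse_fourier[mr mi].
have mN : measurable_fun setT (-%R : R -> R) by exact: oppr_measurable.
rewrite (_ : fourier h = inverse_fourier h \o -%R); last first.
  by apply/funext => y; exact: fourierE.
by split; [apply: (measurableT_comp mr mN)|apply: (measurableT_comp mi mN)].
Qed.

Lemma cmeasurable_mollify g e : 0 < e -> cintegrable leb g -> cmeasurable (mollify e g).
Proof.
move=> e0 ig.
rewrite (_ : mollify e g = fourier (fun x => (damping e x)%:C * inverse_fourier g x)).
  exact/cmeasurable_fourier/cintegrable_damped_inverse_fourier.
by apply/funext => y; rewrite fourier_damped.
Qed.

(** By [damped_pairing] with [g1 = g2 = g], the damped integrals are bounded by the [L^1] norm of
    [g] times the uniform bound [B * (2 * pi)] on its mollifications. The damping increases to [1],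
    so monotone convergence concludes. *)
Lemma cabs_sqr_inverse_fourier_integrable A B g : amplitude A B g ->
  leb.-integrable setT (EFin \o (fun x => cabs (inverse_fourier g x) ^+ 2)).
Proof.
move=> ag; have [mg gB gA _] := ag; have ig := amplitude_integrable ag.
have B0 : 0 <= B := le_trans (cabs_ge0 (g 0)) (gB 0).
have mF := cmeasurable_inverse_fourier ig.
have mF2 : measurable_fun setT (fun x => cabs (inverse_fourier g x) ^+ 2).
  by apply: measurable_funX; exact: measurable_cabs.
pose w n x : R := damping (harmonic n) x * cabs (inverse_fourier g x) ^+ 2.
pose G : R := \int[leb]_x cabs (g x).
have mw n : measurable_fun setT (w n).
  by apply: measurable_funM => //; exact: measurable_damping.
have w0 n x : 0 <= w n x by rewrite mulr_ge0 ?damping_ge0 ?sqr_ge0.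
have iw n : leb.-integrable setT (EFin \o w n).
  apply: (le_integrable _ _ _ (integrableZl measurableT (G ^+ 2) (integrable_damping (harmonic_gt0 n)))) => //.
    by apply/measurable_EFinP; exact: mw.
  move=> x _; rewrite /= lee_fin ger0_norm ?w0 // ger0_norm; last first.
    by rewrite mulr_ge0 ?sqr_ge0 ?damping_ge0.
  rewrite /w mulrC; apply: ler_wpM2r; first exact: damping_ge0.
  rewrite lerXn2r ?nnegrE //; first exact: cabs_ge0.
    by apply: Rintegral_ge0 => z _; exact: cabs_ge0.
  exact: cabs_inverse_fourier_le.
have wK n : (\int[leb]_x (w n x)%:E <= (G * (B * (2 * pi)))%:E)%E.
  rewrite -(fineK (integrable_fin_num measurableT (iw n))) lee_fin.
  apply: (@le_trans _ _ (cabs (cintegral leb (fun y => ((g y)^*)%R * mollify (harmonic n) g y)))).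
    rewrite -damped_pairing ?harmonic_gt0 //; apply: le_trans (Re_le_cabs _).
    rewrite le_eqVlt; apply/orP; left; apply/eqP; apply: eq_Rintegral => x _.
    by rewrite mulr_conj -rmorphM.
  have le_m y : cabs (((g y)^*)%R * mollify (harmonic n) g y) <= B * (2 * pi) * cabs (g y).
    rewrite cabsM cabs_conj mulrC; apply: ler_wpM2r; first exact: cabs_ge0.
    by apply: mollify_le => //; exact: harmonic_gt0.
  have mh : cmeasurable (fun y => ((g y)^*)%R * mollify (harmonic n) g y).
    apply: cmeasurableM; first exact: cmeasurable_conj.
    by apply: cmeasurable_mollify => //; exact: harmonic_gt0.
  have iB := integrableZl measurableT (B * (2 * pi)) (cintegrable_cabs ig).
  have ih : cintegrable leb (fun y => ((g y)^*)%R * mollify (harmonic n) g y).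
    by apply: (cintegrable_le _ iB le_m); exact: mh.
  apply: le_trans (cabs_cintegral_le ih) _; rewrite [leRHS]mulrC -RintegralZl //; last first.
    exact: cintegrable_cabs.
  by apply: le_Rintegral => //; exact: cintegrable_cabs.
apply/integrableP; split; first exact/measurable_EFinP.
apply: (@le_lt_trans _ _ (G * (B * (2 * pi)))%:E); last by rewrite ltry.
have nw x m n : (m <= n)%N -> w m x <= w n x.
  move=> mn; apply: ler_wpM2r; first exact: sqr_ge0.
  rewrite /damping ler_expR !mulNr lerN2 ler_wpM2r //.
  by rewrite /harmonic /= lef_pV2 ?posrE ?ltr0n // ler_nat.
have cw x : (w n x)%:E @[n --> \oo] --> (cabs (inverse_fourier g x) ^+ 2)%:E.
  apply: cvg_EFin; first exact: nearW.
  rewrite -[X in _ --> X]mul1r; apply: cvgM; last exact: cvg_cst.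
  exact: damping_cvg1.
have mwE n : measurable_fun setT (fun x : R => (w n x)%:E) by apply/measurable_EFinP.
have w0E n x : setT x -> (0 <= (w n x)%:E)%E by rewrite lee_fin.
have nwE x : setT x -> {homo (fun n => (w n x)%:E) : m n / (m <= n)%N >-> (m <= n)%E}.
  by move=> _ m n mn; rewrite lee_fin nw.
have cm := cvg_monotone_convergence (mu := leb) measurableT mwE w0E nwE.
apply: (@le_trans _ _ (\int[leb]_x limn (fun n => (w n x)%:E))%E).
  apply: le_integral_nonneg => x _; first exact: abse_ge0.
  by rewrite (cvg_lim _ (cw x)) // gee0_abs // lee_fin sqr_ge0.
rewrite -(cvg_lim _ cm) //; apply: lime_le; last exact: nearW.
by apply/cvg_ex; eexists; exact: cm.
Qed.

Lemma integrable_nonneg_le (u v : R -> R) : measurable_fun setT u ->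
  leb.-integrable setT (EFin \o v) -> (forall x, 0 <= u x <= v x) ->
  leb.-integrable setT (EFin \o u).
Proof.
move=> mu iv uv; apply: (le_integrable _ _ _ iv) => //; first by apply/measurable_EFinP.
move=> x _ /=; have /andP[u0 ux] := uv x.
by rewrite lee_fin ger0_norm // (le_trans ux) // ler_norm.
Qed.

Lemma inL2P h : cmeasurable h ->
  leb.-integrable setT (EFin \o (fun x => cabs (h x) ^+ 2)) -> inL2 leb h.
Proof.
move=> mh ih; split; first exact: mh.
rewrite Lpnorm2E poweR_lty //.
by have := integrable_fin_num measurableT ih; rewrite fin_numElt => /andP[].
Qed.

Lemma cabs_mul_conj_le (z w : R[i]) :
  cabs (z * (w^*)%R) <= cabs z ^+ 2 + cabs w ^+ 2.
Proof.
rewrite cabsM cabs_conj; move: (cabs _) (cabs _) => u v.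
by have := sqr_ge0 (u - v); have := sqr_ge0 (u + v); rewrite !expr2; nra.
Qed.

Lemma cintegrable_mul_conj (f h : R -> R[i]) : cmeasurable f -> cmeasurable h ->
  leb.-integrable setT (EFin \o (fun x => cabs (f x) ^+ 2)) ->
  leb.-integrable setT (EFin \o (fun x => cabs (h x) ^+ 2)) ->
  cintegrable leb (fun x => f x * ((h x)^*)%R).
Proof.
move=> mf mh if2 ih2; have iD := integrableD measurableT if2 ih2.
apply: (cintegrable_le _ iD); last by move=> x; exact: cabs_mul_conj_le.
by apply: cmeasurableM; [exact: mf|exact: (cmeasurable_conj mh)].
Qed.

Lemma amplitude_sqr_integrable A B g : amplitude A B g ->
  leb.-integrable setT (EFin \o (fun x => cabs (g x) ^+ 2)).
Proof.
move=> ag; have [mg gB _ _] := ag; have ig := amplitude_integrable ag.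
apply: (le_integrable _ _ _ (integrableZl measurableT B (cintegrable_cabs ig))) => //.
  by apply/measurable_EFinP; apply: measurable_funX; exact: measurable_cabs.
move=> x _; rewrite /= lee_fin normrX ger0_norm ?cabs_ge0 //.
apply: le_trans (ler_norm _); rewrite expr2; apply: ler_wpM2r => //.
exact: cabs_ge0.
Qed.

(** The damping is removed on both sides of [damped_pairing] by dominated convergence: the
    transforms are square integrable by the previous lemmas, and the mollifications of [g1] are
    uniformly bounded and converge almost everywhere to [2 pi * g1]. *)
Lemma inner_inverse_fourier A1 B1 A2 B2 g1 g2 : amplitude A1 B1 g1 -> amplitude A2 B2 g2 ->
  inner leb (inverse_fourier g1) (inverse_fourier g2) = (2 * pi)%:C * inner leb g1 g2.
Proof.
move=> a1 a2; have [m1 b1 _ c1] := a1; have [m2 b2 _ _] := a2.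
have i1 := amplitude_integrable a1; have i2 := amplitude_integrable a2.
have mF1 := cmeasurable_inverse_fourier i1; have mF2 := cmeasurable_inverse_fourier i2.
pose F x := inverse_fourier g1 x * ((inverse_fourier g2 x)^*)%R.
pose H y := ((g2 y)^*)%R * ((2 * pi)%:C * g1 y).
have mF : cmeasurable F by apply: cmeasurableM => //; exact: cmeasurable_conj.
have mH : cmeasurable H.
  apply: cmeasurableM; first exact: cmeasurable_conj.
  by apply: cmeasurableM m1; exact: cmeasurable_cst.
have HE : cintegral leb H = (2 * pi)%:C * inner leb g1 g2.
  rewrite /inner -cintegralZ; first by apply: eq_cintegral => y; rewrite /H; ring.
  apply: (cintegrable_le _ (integrableZl measurableT B2 (cintegrable_cabs i1))).
    by apply: cmeasurableM m1 _; exact: cmeasurable_conj.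
  move=> y; rewrite cabsM cabs_conj mulrC; apply: ler_wpM2r => //.
  exact: cabs_ge0.
rewrite -HE -/F.
have limF : cabs (cintegral leb (fun x => (damping (harmonic n) x)%:C * F x) -
    cintegral leb F) @[n --> \oo] --> (0 : R).
  have iD := integrableD measurableT (cabs_sqr_inverse_fourier_integrable a1)
    (cabs_sqr_inverse_fourier_integrable a2).
  have FD x : cabs (F x) <= cabs (inverse_fourier g1 x) ^+ 2 + cabs (inverse_fourier g2 x) ^+ 2.
    exact: cabs_mul_conj_le.
  apply: (dominated_cintegral_cvg _ _ iD) => //.
  - move=> n; apply: cmeasurableM mF; apply: cmeasurable_real.
    exact: measurable_damping.
  - move=> n x; apply: le_trans (FD x); rewrite cabsM cabs_real ger0_norm ?damping_ge0 //.
    by rewrite ler_piMl ?cabs_ge0 // damping_le1 // ltW // harmonic_gt0.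
  - apply: aeW => x.
    have c : (`|damping (harmonic n) x - 1| * cabs (F x)) @[n --> \oo] --> (0 : R).
      rewrite -(mul0r (cabs (F x))); apply: cvgM; last exact: cvg_cst.
      rewrite -(@normr0 _ R) -(subrr (1 : R)); apply: cvg_norm; apply: cvgB (cvg_cst _).
      exact: damping_cvg1.
    apply: cvg_trans c; apply: near_eq_cvg; apply: nearW => n.
    exact/esym/cabs_damping_sub.
have limH : cabs (cintegral leb (fun y => ((g2 y)^*)%R * mollify (harmonic n) g1 y) -
    cintegral leb H) @[n --> \oo] --> (0 : R).
  have b10 : 0 <= B1 := le_trans (cabs_ge0 (g1 0)) (b1 0).
  have iD := integrableZl measurableT (B1 * (2 * pi)) (cintegrable_cabs i2).
  apply: (dominated_cintegral_cvg _ _ iD) => //.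
  - move=> n; apply: cmeasurableM; first exact: cmeasurable_conj.
    by apply: cmeasurable_mollify => //; exact: harmonic_gt0.
  - move=> n y; rewrite cabsM cabs_conj mulrC; apply: ler_wpM2r; first exact: cabs_ge0.
    by apply: mollify_le => //; exact: harmonic_gt0.
  - move=> y; rewrite !cabsM cabs_conj mulrC; apply: ler_wpM2r; first exact: cabs_ge0.
    rewrite cabs_real ger0_norm ?mulr_ge0 ?pi_ge0 // mulrC.
    by apply: ler_wpM2r => //; rewrite mulr_ge0 ?pi_ge0.
  - apply: (@filterS _ _ (ae_filter_ringOfSetsType _)) c1 => y cy.
    have c : (cabs (g2 y) * cabs (mollify (harmonic n) g1 y - (2 * pi)%:C * g1 y))
        @[n --> \oo] --> (0 : R).
      rewrite -(mulr0 (cabs (g2 y))); apply: cvgM; first exact: cvg_cst.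
      exact: mollify_cvg a1 cy.
    apply: cvg_trans c; apply: near_eq_cvg; apply: nearW => n.
    by rewrite -mulrBr cabsM cabs_conj.
have E n : cintegral leb (fun x => (damping (harmonic n) x)%:C * F x) =
    cintegral leb (fun y => ((g2 y)^*)%R * mollify (harmonic n) g1 y).
  by rewrite -damped_pairing ?harmonic_gt0.
apply/eqP; rewrite -subr_eq0 -cabs_eq0; apply/eqP.
pose z := cintegral leb F - cintegral leb H.
(* The two approximating integrals agree for each [n], so the distance between their limits is at
   most the sum of the two errors. *)
have le_z n : cabs z <=
    cabs (cintegral leb (fun x => (damping (harmonic n) x)%:C * F x) - cintegral leb F) +
    cabs (cintegral leb (fun y => ((g2 y)^*)%R * mollify (harmonic n) g1 y) - cintegral leb H).
  rewrite -E -[X in X + _]cabsN; apply: le_trans (ler_cabsD _ _).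
  by rewrite opprB addrA subrK.
apply/eqP; rewrite eq_le cabs_ge0 andbT -/z; have := cvgD limF limH.
rewrite addr0 => /(_ eventually_filter) c.
have := cvg_lim (@Rhausdorff R) c => <-.
apply: limr_ge; first by apply/cvg_ex; eexists; exact: c.
by apply: nearW => n; exact: le_z.
Qed.

(** The approximants in [L^1] and [L^2] are the damped functions. Their Fourier transforms are the
    mollifications of [g] divided by [2 pi], which converge to [g] almost everywhere under the
    majorant from [mollify_dominated]. *)
Lemma is_fourierL2_inverse A B g : amplitude A B g ->
  is_fourierL2 (fun x => ((2 * pi)^-1)%:C * inverse_fourier g x) g.
Proof.
move=> ag; have [mg gB _ cg] := ag; have ig := amplitude_integrable ag.
set c : R := (2 * pi)^-1.
have pi20 : 0 < 2 * pi :> R by rewrite mulr_gt0 // pi_gt0.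
have c0 : 0 < c by rewrite invr_gt0.
pose f x := c%:C * inverse_fourier g x.
have mF := cmeasurable_inverse_fourier ig.
have mf : cmeasurable f by apply: cmeasurableM mF; exact: cmeasurable_cst.
have if2 : leb.-integrable setT (EFin \o (fun x => cabs (f x) ^+ 2)).
  have := integrableZl measurableT (c ^+ 2) (cabs_sqr_inverse_fourier_integrable ag).
  apply: eq_integrable => // x _.
  change ((c ^+ 2 * cabs (inverse_fourier g x) ^+ 2)%:E = (cabs (f x) ^+ 2)%:E).
  by rewrite /f cabsM cabs_real exprMn real_normK ?num_real.
pose h n x := (damping (harmonic n) x)%:C * f x.
have mh n : cmeasurable (h n).
  by apply: cmeasurableM mf; apply: cmeasurable_real; exact: measurable_damping.
have hE n x : h n x = c%:C * ((damping (harmonic n) x)%:C * inverse_fourier g x).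
  by rewrite /h /f mulrCA.
have d1 n x : damping (harmonic n) x <= 1 :> R by rewrite damping_le1 // ltW // harmonic_gt0.
have fh n y : fourier (h n) y = c%:C * mollify (harmonic n) g y.
  rewrite -fourier_damped ?harmonic_gt0 // -cintegralZ.
    by apply: eq_cintegral => x; rewrite hE mulrCA.
  apply: cintegrable_cis; first by apply: measurableT_comp => //; apply: measurable_funM.
  exact: cintegrable_damped_inverse_fourier (harmonic_gt0 n) ig.
split; [exact: inL2P|exact: inL2P (amplitude_sqr_integrable ag)|exists h].
  move=> n; split.
    have := cintegrable_damped_inverse_fourier (harmonic_gt0 n) ig.
    move=> /cintegrable_cabs/(integrableZl measurableT c) ic.
    apply: (cintegrable_le _ ic); first exact: mh.
    by move=> x; rewrite hE cabsM cabs_real gtr0_norm.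
  apply: inL2P => //; apply: (integrable_nonneg_le _ if2).
    by apply: measurable_funX; exact: measurable_cabs (mh n).
  move=> x; apply/andP; split; first exact: sqr_ge0.
  apply: lerXn2r; rewrite ?nnegrE; [exact: cabs_ge0|exact: cabs_ge0|].
  rewrite cabsM cabs_real ger0_norm ?damping_ge0 // ler_piMl //.
  exact: cabs_ge0.
split.
  apply: (Lpnorm2_cvg0 _ if2).
  - by move=> n; exact: cmeasurableB (mh n) mf.
  - move=> n x; rewrite cabs_damping_sub exprMn -[leRHS]mul1r.
    rewrite ler_wpM2r ?sqr_ge0 // expr_le1 // ler_norml.
    by have := d1 n x; have := damping_ge0 (harmonic n) x; lra.
  - apply: aeW => x.
    have : (`|damping (harmonic n) x - 1| * cabs (f x)) @[n --> \oo] --> (0 : R).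
      rewrite -(mul0r (cabs (f x))); apply: cvgM; last exact: cvg_cst.
      rewrite -(@normr0 _ R) -(subrr (1 : R)); apply: cvg_norm; apply: cvgB (cvg_cst _).
      exact: damping_cvg1.
    apply: cvg_trans; apply: near_eq_cvg; apply: nearW => n.
    exact/esym/cabs_damping_sub.
have [C C0 dom] := mollify_dominated ag.
(* The majorant comes from [(c u + v) ^ 2 <= 2 c ^ 2 u ^ 2 + 2 v ^ 2], where [u] and [v] are the
   moduli of the mollification and of [g]. *)
have iD : leb.-integrable setT
    (EFin \o (fun y : R => 2 * c ^+ 2 * C * poisson 1 (y - 0) + 2 * cabs (g y) ^+ 2)).
  exact: (integrableD measurableT
    (integrableZl measurableT (2 * c ^+ 2 * C) (integrable_poisson 0 ltr01))
    (integrableZl measurableT 2 (amplitude_sqr_integrable ag))).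
apply: (Lpnorm2_cvg0 _ iD).
- move=> n; apply: cmeasurableB mg.
  have -> : fourier (h n) = (fun y => c%:C * mollify (harmonic n) g y).
    by apply/funext => y; exact: fh.
  apply: cmeasurableM; first exact: cmeasurable_cst.
  by apply: cmeasurable_mollify => //; exact: harmonic_gt0.
- move=> n y; rewrite fh subr0.
  have dm : cabs (mollify (harmonic n) g y) ^+ 2 <= C * poisson 1 y.
    by apply: dom; rewrite harmonic_gt0 harmonic_le1.
  apply: (@le_trans _ _ ((c * cabs (mollify (harmonic n) g y) + cabs (g y)) ^+ 2)).
    rewrite lerXn2r ?nnegrE ?cabs_ge0 //.
      by apply: addr_ge0; [apply: mulr_ge0; [exact: ltW|]|]; exact: cabs_ge0.
    by apply: le_trans (ler_cabsD _ _) _; rewrite cabsN cabsM cabs_real gtr0_norm.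
  move: (cabs (mollify _ _ _)) (cabs (g y)) (poisson 1 y) dm => u v p dm.
  have : c ^+ 2 * u ^+ 2 <= c ^+ 2 * (C * p) by rewrite ler_wpM2l ?sqr_ge0.
  by have := sqr_ge0 (c * u - v); rewrite !expr2; lra.
apply: (@filterS _ _ (ae_filter_ringOfSetsType _)) cg => y cy.
have : (c * cabs (mollify (harmonic n) g y - (2 * pi)%:C * g y)) @[n --> \oo] --> (0 : R).
  rewrite -(mulr0 c); apply: cvgM; first exact: cvg_cst.
  exact: mollify_cvg ag cy.
apply: cvg_trans; apply: near_eq_cvg; apply: nearW => n.
rewrite fh -{1}[c](gtr0_norm c0) -cabs_real -cabsM mulrBr mulrA -rmorphM /=.
by rewrite /c mulVf ?mul1r // gt_eqF.
Qed.

End InverseFourierL2.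

(** * Wave packets *)

Section Trigonometry.
Context {R : realType}.
Implicit Types x y : R.

Lemma sin_le_id x : 0 <= x -> sin x <= x.
Proof.
rewrite le_eqVlt => /predU1P[<-|x0]; first by rewrite sin0.
have dsin (z : R) : z \in `]0, x[ -> is_derive z 1 (@sin R) (cos z).
  by move=> _; exact: is_derive_sin.
have csin : {within `[0, x], continuous (@sin R)}.
  by apply: continuous_subspaceT; exact: continuous_sin.
have [c _] := MVT x0 dsin csin.
by rewrite sin0 !subr0 => ->; rewrite ler_piMl ?cos_le1 // ltW.
Qed.

Lemma sin_sqr_le x : sin x ^+ 2 <= x ^+ 2.
Proof.
wlog x0 : x / 0 <= x => [H|].
  have [/H//|/ltW x0] := leP 0 x.
  by rewrite -(sqrrN x) -(sqrrN (sin x)) -sinN H // oppr_ge0.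
have [s0|s0] := leP 0 (sin x).
  by rewrite lerXn2r ?nnegrE // sin_le_id.
rewrite -sqrrN lerXn2r ?nnegrE ?oppr_ge0 ?(ltW s0) //.
have [x1|x1] := leP x 1; last first.
  by rewrite (le_trans _ (ltW x1)) // lerNl sin_geN1.
have : 0 <= sin x.
  by rewrite sin_ge0_pi // x0 (le_trans x1) // (le_trans _ (pi_ge2 R)) // ler1n.
by rewrite leNgt s0.
Qed.

Lemma cos_ge_quadratic x : 1 - x ^+ 2 / 2 <= cos x.
Proof.
have -> : cos x = 1 - 2 * sin (x / 2) ^+ 2.
  rewrite {1}[x]splitr cosD -!expr2.
  by have := cos2Dsin2 (x / 2); lra.
have := sin_sqr_le (x / 2); rewrite expr_div_n; lra.
Qed.

Lemma cabs_cis_sub x y : cabs (cis x - cis y) <= `|x - y|.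
Proof.
rewrite cabsE -sqrtr_sqr ler_wsqrtr //= -![cos x + - _]/(cos x - _).
have := cos_ge_quadratic (x - y); rewrite cosB.
have := cos2Dsin2 x; have := cos2Dsin2 y.
by rewrite !expr2; nra.
Qed.

Lemma sinD_2pi_int (n : int) x : sin (x + 2 * pi * n%:~R) = sin x.
Proof.
have E (m : nat) y : sin (y + 2 * pi * m%:R) = sin y.
  by rewrite mulr_natr [2 * pi]mulr_natl; exact: periodicn (@sinD2pi R) m y.
case: n => m; first exact: E.
rewrite NegzE rmorphN /= mulrN.
by rewrite -[in RHS](subrK (2 * pi * m.+1%:R) x) E.
Qed.

Lemma cosD_2pi_int (n : int) x : cos (x + 2 * pi * n%:~R) = cos x.
Proof.
have E (m : nat) y : cos (y + 2 * pi * m%:R) = cos y.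
  by rewrite mulr_natr [2 * pi]mulr_natl; exact: periodicn (@cosD2pi R) m y.
case: n => m; first exact: E.
rewrite NegzE rmorphN /= mulrN.
by rewrite -[in RHS](subrK (2 * pi * m.+1%:R) x) E.
Qed.

End Trigonometry.

Section IntervalIntegral.
Context {R : realType}.

Lemma Rintegral_indic_FTC (f F : R -> R) (a b : R) : a < b ->
  (forall x : R, is_derive x 1 F (f x)) -> continuous f ->
  \int[leb]_x (\1_(`[a, b[%classic : set R) x * f x) = F b - F a.
Proof.
move=> ab dF cf.
have cF : continuous F.
  by move=> x; apply/differentiable_continuous/derivable1_diffP; have [] := dF x.
have H : (\int[leb]_(x in `[a, b]) (f x)%:E = (F b)%:E - (F a)%:E)%E.
  apply: continuous_FTC2 => //.
  - exact: continuous_subspaceT.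
  - split; first by move=> x _; have [] := dF x.
      by apply: cvg_at_right_filter; exact: cF.
    by apply: cvg_at_left_filter; exact: cF.
  - by move=> x _; rewrite derive1E; have [_ ->] := dF x.
rewrite -EFinB in H; rewrite -[RHS]/(fine (F b - F a)%:E) -H.
rewrite /Rintegral; congr fine.
rewrite -integral_itv_bndo_bndc; last first.
  by apply: measurable_funTS; apply/measurable_EFinP; exact: continuous_measurable_fun.
rewrite [RHS]integral_mkcond; apply: eq_integral => x _.
rewrite patchE indicE; case: (x \in _); first by rewrite mul1r.
by rewrite mul0r.
Qed.

End IntervalIntegral.

Section WavePackets.
Context {R : realType}.
Implicit Types (k : nat) (m : int) (t x xi : R).

Definition unit_band k : R -> R := \1_(`[k%:R, k%:R + 1[%classic : set R).

(** The linear term translates the packet to [2 pi (m + 1/2)]; the quadratic one is the Schroedinger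
    phase, so that time is built into the packet. *)
Definition packet_phase t m xi : R := - (2 * pi * (m%:~R + 2^-1) * xi + t * xi ^+ 2).

(** The factor [Num.sqrt (2 * pi)] gives [packet] unit norm: Parseval contributes [2 pi], and the
    prefactor of [packet] contributes [(2 pi) ^ -2]. *)
Definition packet_fourier t k m xi : R[i] :=
  (Num.sqrt (2 * pi) * unit_band k xi)%:C * cis (packet_phase t m xi).

Definition packet t k m x : R[i] :=
  ((2 * pi)^-1)%:C * inverse_fourier (packet_fourier t k m) x.

Let pi2 : 0 < 2 * pi :> R.
Proof. by rewrite mulr_gt0 // pi_gt0. Qed.

Lemma measurable_unit_band k : measurable_fun setT (unit_band k).
Proof. by apply: measurable_indic; exact: measurable_itv. Qed.

Lemma unit_band_in k xi : k%:R <= xi < k%:R + 1 -> unit_band k xi = 1.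
Proof. by move=> h; rewrite /unit_band indicE mem_set //= in_itv. Qed.

Lemma unit_band_out k xi : ~~ (k%:R <= xi < k%:R + 1) -> unit_band k xi = 0.
Proof.
by move=> h; rewrite /unit_band indicE memNset //= in_itv; exact/negP.
Qed.

Lemma packet_fourier_out t k m xi : ~~ (k%:R <= xi < k%:R + 1) ->
  packet_fourier t k m xi = 0.
Proof. by move=> h; rewrite /packet_fourier unit_band_out // mulr0 rmorph0 mul0r. Qed.

Lemma continuous_packet_phase t m : continuous (packet_phase t m).
Proof.
move=> x; apply: cvgN; apply: cvgD.
  by apply: cvgM; [exact: cvg_cst|exact: cvg_id].
by apply: cvgM; [exact: cvg_cst|exact: exprn_continuous].
Qed.

Lemma packet_amplitude t k m :
  amplitude (k%:R + 1) (Num.sqrt (2 * pi)) (packet_fourier t k m).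
Proof.
have s0 : 0 <= Num.sqrt (2 * pi) :> R by exact: sqrtr_ge0.
split.
- apply: cmeasurableM.
    by apply: cmeasurable_real; apply: measurable_funM => //; exact: measurable_unit_band.
  by apply: cmeasurable_cis; apply: continuous_measurable_fun; exact: continuous_packet_phase.
- move=> x; rewrite cabsM cabs_cis mulr1 cabs_real ger0_norm ?mulr_ge0 //.
  rewrite ler_piMr // /unit_band indicE.
  by case: (_ \in _).
- move=> x kx; rewrite packet_fourier_out //.
  apply/negP => /andP[x1 x2]; move: kx; rewrite ger0_norm ?(le_trans _ x1) //.
  by move=> /(lt_trans x2); rewrite ltxx.
(* The exceptional null set: the cutoff jumps only at the endpoints of the band. Elsewhere a small
   neighbourhood lies wholly outside or inside the band, and inside only the continuous phase
   varies. *)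
exists [set k%:R; k%:R + 1 : R]; split.
- by apply: measurableU; exact: measurable_set1.
- by apply: countable_lebesgue_measure0; apply: finite_set_countable; exact: finite_set2.
move=> x nx; apply: contrapT => xk; apply: nx => r r0.
have xk0 : x != k%:R by apply/eqP => e; apply: xk; left.
have xk1 : x != k%:R + 1 by apply/eqP => e; apply: xk; right.
have [inb|outb] := boolP (k%:R <= x < k%:R + 1); last first.
  have [xl|xr] := ltP x k%:R.
    exists (k%:R - x); first by rewrite subr_gt0.
    move=> y; rewrite ltr_norml => /andP[_ yx].
    have oy : ~~ (k%:R <= y < k%:R + 1) by apply/negP => /andP[+ _]; lra.
    by rewrite !packet_fourier_out // subrr cabs0 ltW.
  have xr1 : k%:R + 1 < x.
    by rewrite lt_neqAle eq_sym xk1 /= leNgt; move: outb; rewrite xr.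
  exists (x - (k%:R + 1)); first by rewrite subr_gt0.
  move=> y; rewrite ltr_norml => /andP[yx _].
  have oy : ~~ (k%:R <= y < k%:R + 1) by apply/negP => /andP[_]; lra.
  by rewrite !packet_fourier_out // subrr cabs0 ltW.
have /andP[xl xr] := inb.
have xl' : k%:R < x by rewrite lt_neqAle eq_sym xk0.
have := @continuous_packet_phase t m x.
have e0 : 0 < r / (Num.sqrt (2 * pi) + 1) by rewrite divr_gt0 // ltr_wpDl.
move=> /cvgrPdist_lt /(_ _ e0) /nbhs_ballP[d d0 dball].
exists (Num.min d (Num.min (x - k%:R) (k%:R + 1 - x))).
  by rewrite !lt_min (d0 : 0 < d) !subr_gt0 xl' xr.
move=> y; rewrite !lt_min => /andP[yd /andP[y1 y2]].
move: y1 y2; rewrite !ltr_norml => /andP[y1 _] /andP[_ y2].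
rewrite /packet_fourier !unit_band_in //; last by lra.
rewrite mulr1 -mulrBr cabsM cabs_real ger0_norm //.
have /ltW yx : `|packet_phase t m x - packet_phase t m y| < r / (Num.sqrt (2 * pi) + 1).
  by apply: dball; rewrite /ball /= distrC.
apply: (@le_trans _ _ (Num.sqrt (2 * pi) * (r / (Num.sqrt (2 * pi) + 1)))).
  by rewrite ler_wpM2l // (le_trans (cabs_cis_sub _ _)) // distrC.
by rewrite mulrCA ler_piMr ?(ltW r0) // ler_pdivrMr ?mul1r ?lerDl // ltr_wpDl.
Qed.

Lemma packet_fourierL2 t k m : is_fourierL2 (packet t k m) (packet_fourier t k m).
Proof. exact: is_fourierL2_inverse (packet_amplitude t k m). Qed.

Lemma packet_schrodinger t k m : is_schrodinger t (packet 0 k m) (packet t k m).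
Proof.
exists (packet_fourier 0 k m); first exact: packet_fourierL2.
have -> : (fun xi => cis (- (t * `|xi| ^+ 2)) * packet_fourier 0 k m xi) =
    packet_fourier t k m.
  apply/funext => xi; rewrite /packet_fourier mulrCA -cisD; congr (_ * cis _).
  by rewrite real_normK ?num_real // /packet_phase; ring.
exact: packet_fourierL2.
Qed.

Lemma is_derive_sin_mulr (a x : R) : a != 0 ->
  is_derive x 1 (fun y : R => a^-1 * sin (a * y)) (cos (a * x)).
Proof.
move=> a0; have da := is_derive_mulr a x.
have h := is_deriveZ a^-1 (is_derive1_comp (is_derive_sin (a * x)) da).
by apply: (is_derive_eq h); rewrite /GRing.scale /= mulrCA mulVf ?mulr1.
Qed.

Lemma is_derive_cos_mulr (a x : R) : a != 0 ->
  is_derive x 1 (fun y : R => - a^-1 * cos (a * y)) (sin (a * x)).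
Proof.
move=> a0; have da := is_derive_mulr a x.
have h := is_deriveZ (- a^-1) (is_derive1_comp (is_derive_cos (a * x)) da).
by apply: (is_derive_eq h); rewrite /GRing.scale /= mulNr mulNr mulrN opprK mulrCA mulVf ?mulr1.
Qed.

(** A unit band contains whole periods of an integer frequency, so the primitives take equal values
    at its two ends. *)
Lemma cintegral_band_cis k (n : int) : n != 0 ->
  cintegral leb (fun xi => (unit_band k xi)%:C * cis (2 * pi * n%:~R * xi)) = 0.
Proof.
move=> n0; set a : R := 2 * pi * n%:~R.
have a0 : a != 0 by rewrite mulf_neq0 ?intr_eq0 // gt_eqF.
have k1 : k%:R < k%:R + 1 :> R by rewrite ltrDl.
have ca : continuous (fun x : R => a * x).
  by move=> x; apply: cvgM; [exact: cvg_cst|exact: cvg_id].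
have ks : a * (k%:R + 1) = a * k%:R + 2 * pi * n%:~R by rewrite mulrDr mulr1.
apply/eqP; rewrite eq_complex /=; apply/andP; split; apply/eqP.
  transitivity (\int[leb]_x (\1_(`[k%:R, k%:R + 1[%classic : set R) x * cos (a * x))).
    by apply: eq_Rintegral => x _; rewrite mul0r subr0.
  rewrite (Rintegral_indic_FTC k1 (fun x => is_derive_sin_mulr x a0)).
    by rewrite ks sinD_2pi_int subrr.
  by move=> x; exact: (continuous_comp (ca x) (@continuous_cos R _)).
transitivity (\int[leb]_x (\1_(`[k%:R, k%:R + 1[%classic : set R) x * sin (a * x))).
  by apply: eq_Rintegral => x _; rewrite mul0r addr0.
rewrite (Rintegral_indic_FTC k1 (fun x => is_derive_cos_mulr x a0)).
  by rewrite ks cosD_2pi_int subrr.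
by move=> x; exact: (continuous_comp (ca x) (@continuous_sin R _)).
Qed.

Lemma complex_conjM (z w : R[i]) : ((z * w)^*)%R = (z^*)%R * (w^*)%R.
Proof. exact: rmorphM. Qed.

Lemma conj_realC (r : R) : ((r%:C)^*)%R = r%:C.
Proof. by rewrite -[LHS]/(conjc r%:C); apply/eqP; rewrite eq_complex /= oppr0 !eqxx. Qed.

Lemma integral_unit_band k : \int[leb]_x unit_band k x = 1.
Proof. by rewrite /Rintegral integral_indic_itv ?lerDl // addrAC subrr add0r. Qed.

Lemma cintegrable_band_cis k (h : R -> R) : measurable_fun setT h ->
  cintegrable leb (fun xi => (unit_band k xi)%:C * cis (h xi)).
Proof.
move=> mh; apply: (cintegrable_le _ (integrable_indic_itv k%:R (k%:R + 1) true true)).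
  apply: cmeasurableM; last exact: cmeasurable_cis.
  by apply: cmeasurable_real; exact: measurable_unit_band.
by move=> xi; rewrite cabsM cabs_cis mulr1 cabs_real ger0_norm // /unit_band indicE.
Qed.

(** Different bands are disjoint. Within one band the shifts by [1/2] cancel and leave an
    exponential of integer frequency [m' - m]. *)
Lemma inner_packet_fourier k m k' m' :
  inner leb (packet_fourier 0 k m) (packet_fourier 0 k' m') =
  (2 * pi)%:C * ((k == k') && (m == m'))%:R.
Proof.
have [<-|kk] /= := eqVneq k k'; last first.
  rewrite mulr0 /inner (eq_cintegral leb (g := fun=> (0 : R)%:C)).
    by rewrite cintegral_real /Rintegral integral0.
  move=> xi; have [xk|xk] := boolP (k%:R <= xi < k%:R + 1); last first.
    by rewrite packet_fourier_out // mul0r rmorph0.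
  rewrite [X in _ * X](_ : _ = 0) ?mulr0 ?rmorph0 //.
  rewrite packet_fourier_out ?rmorph0 //; apply/negP => xk'.
  by move: xk xk' kk; rewrite neq_ltn -!(ler_nat R) -!natr1 => /andP[x1 x2] /andP[x3 x4] /orP[]; lra.
have E xi : packet_fourier 0 k m xi * ((packet_fourier 0 k m' xi)^*)%R =
    (2 * pi)%:C * ((unit_band k xi)%:C * cis (2 * pi * (m' - m)%:~R * xi)).
  have bb : unit_band k xi * unit_band k xi = unit_band k xi.
    by rewrite /unit_band indicE; case: (_ \in _); rewrite ?mulr1 ?mulr0.
  rewrite /packet_fourier complex_conjM conj_realC -cisN mulrACA -cisD -rmorphM.
  rewrite mulrACA bb -expr2 sqr_sqrtr ?(ltW pi2) // rmorphM -mulrA.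
  by congr (_ * (_ * cis _)); rewrite /packet_phase rmorphB /=; ring.
rewrite /inner (eq_cintegral leb E) cintegralZ; last first.
  by apply: cintegrable_band_cis; exact: measurable_funM.
congr (_ * _); have [<-|mm] /= := eqVneq m m'.
  rewrite (eq_cintegral leb (g := fun xi => (unit_band k xi)%:C)).
    by rewrite cintegral_real integral_unit_band.
  by move=> xi; rewrite subrr mulr0 mul0r cis0 mulr1.
by rewrite cintegral_band_cis // subr_eq0 eq_sym.
Qed.

Lemma inner_packet k m k' m' :
  inner leb (packet 0 k m) (packet 0 k' m') = ((k == k') && (m == m'))%:R.
Proof.
have am := packet_amplitude 0 k m; have am' := packet_amplitude 0 k' m'.
have c0 : (2 * pi)^-1 * (2 * pi) = 1 :> R by rewrite mulVf // gt_eqF.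
have E x : packet 0 k m x * ((packet 0 k' m' x)^*)%R = (((2 * pi)^-1 * (2 * pi)^-1) : R)%:C *
    (inverse_fourier (packet_fourier 0 k m) x *
     ((inverse_fourier (packet_fourier 0 k' m') x)^*)%R).
  by rewrite /packet complex_conjM conj_realC mulrACA -rmorphM.
rewrite /inner (eq_cintegral leb E) cintegralZ; last first.
  apply: cintegrable_mul_conj.
  - exact/cmeasurable_inverse_fourier/(amplitude_integrable am).
  - exact/cmeasurable_inverse_fourier/(amplitude_integrable am').
  - exact: cabs_sqr_inverse_fourier_integrable am.
  - exact: cabs_sqr_inverse_fourier_integrable am'.
rewrite -/(inner leb (inverse_fourier _) (inverse_fourier _)).
rewrite (inner_inverse_fourier am am') inner_packet_fourier.
rewrite mulrA -rmorphM mulrA -rmorphM; move: (2 * pi) c0 => p c0.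
rewrite (_ : p^-1 * p^-1 * p * p = (p^-1 * p) * (p^-1 * p)); last by ring.
by rewrite c0 mulr1 rmorph1 mul1r.
Qed.

(** Centring the frequency at the midpoint [c] of the band and factoring out a unimodular constant
    leaves the phase [th]. On the tube its cosine has integral at least [1/4] over the band, so the
    transform is at least [sqrt (2 pi) / 4] in modulus; squaring and multiplying by [(2 pi) ^ -2]
    gives [1 / (32 pi)]. *)
Lemma cabs_packet_ge t k m x : 0 <= t <= 10^-1 ->
  `|x - 2 * pi * (m%:~R + 2^-1) - 2 * t * (k%:R + 2^-1)| <= pi ->
  (32 * pi)^-1 <= cabs (packet t k m x) ^+ 2.
Proof.
move=> /andP[t0 t1]; set y := (X in `|X|) => yp.
pose c : R := k%:R + 2^-1.
pose th xi : R := y * (xi - c) - t * (xi - c) ^+ 2.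
pose th0 : R := x * c + packet_phase t m c.
have ag := packet_amplitude t k m; have ig := amplitude_integrable ag.
have thE xi : - th0 + (x * xi + packet_phase t m xi) = th xi.
  by rewrite /th0 /packet_phase /th /y -/c; field.
(* Here [2 * a = 4.1 ^ 2], which exceeds [(4 + 1/20) ^ 2]: on the band [|y| <= 4] and
   [t * |xi - c| <= 1/20], hence [th xi ^+ 2 <= 2 * a * (xi - c) ^+ 2]. Yet [a] is small enough for
   the integral [1 - a / 12] of [q] to exceed [1/4]. *)
pose a : R := 8405 / 1000.
pose q xi : R := 1 - a * (xi - c) ^+ 2.
have qcos xi : k%:R <= xi < k%:R + 1 -> q xi <= cos (th xi).
  move=> /andP[xl xr]; apply: le_trans (cos_ge_quadratic _).
  rewrite /q lerD2l lerN2 ler_pdivrMr // /th.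
  have : `|y| <= 4 by apply: le_trans yp _; have := @pihalf_lt2 R; lra.
  have : - 2^-1 <= xi - c <= 2^-1 by rewrite /c; lra.
  rewrite ler_norml; move: (xi - c) (y) => e z e1 z4.
  have te : - 20^-1 <= t * e <= 20^-1 by nra.
  have zt : (z - t * e) ^+ 2 <= 2 * a by rewrite /a expr2; nra.
  rewrite (_ : z * e - _ = e * (z - t * e)); last by ring.
  rewrite exprMn (_ : a * e ^+ 2 * 2 = e ^+ 2 * (2 * a)); last by ring.
  by apply: ler_wpM2l => //; exact: sqr_ge0.
have cq : continuous q.
  have -> : q = cst 1 - a \*: (id - cst c) ^+ 2 by apply/funext => u; rewrite !fctE.
  by move=> x'; apply/differentiable_continuous/derivable1_diffP; exact: ex_derive.
have I1 : 4^-1 <= \int[leb]_xi (unit_band k xi * q xi).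
  have dF (x' : R) : is_derive x' 1 (id - (a / 3) \*: (id - cst c) ^+ 3) (q x').
    apply: is_derive_eq; rewrite !fctE /= /GRing.scale /= /q.
    by rewrite subr0 mulr1; field.
  have k1 : k%:R < k%:R + 1 :> R by rewrite ltrDl.
  rewrite (Rintegral_indic_FTC k1 dF cq) !fctE /= /GRing.scale /= /a /c.
  rewrite (_ : k%:R + 1 - (k%:R + 2^-1) = 2^-1); last by field.
  rewrite (_ : k%:R - (k%:R + 2^-1) = - 2^-1); last by ring.
  by rewrite !exprS expr0; lra.
have mth : measurable_fun setT th.
  have -> : th = y \*: (id - cst c) - t \*: (id - cst c) ^+ 2 by apply/funext => u; rewrite !fctE.
  apply: continuous_measurable_fun => x'.
  by apply/differentiable_continuous/derivable1_diffP; exact: ex_derive.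
have icos : leb.-integrable setT (EFin \o (fun xi => unit_band k xi * cos (th xi))).
  have [ir _] := cintegrable_band_cis k mth.
  by apply: eq_integrable ir => // xi _; congr _%:E; rewrite /= mul0r subr0.
have I2 : \int[leb]_xi (unit_band k xi * q xi) <= \int[leb]_xi (unit_band k xi * cos (th xi)).
  apply: le_Rintegral => //.
    have := integrableZl measurableT (1 + a) (integrable_indic_itv k%:R (k%:R + 1) true true).
    apply: le_integrable => //.
      apply/measurable_EFinP; apply: measurable_funM (measurable_unit_band k) _.
      exact: continuous_measurable_fun.
    move=> xi _; rewrite lee_fin.
    change (`|unit_band k xi * q xi| <= `|(1 + a) * unit_band k xi|).
    have [xk|xk] := boolP (k%:R <= xi < k%:R + 1); last by rewrite unit_band_out // mul0r mulr0.
    rewrite unit_band_in // mul1r mulr1 [leRHS]ger0_norm; last by rewrite /a; lra.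
    have : - 2^-1 <= xi - c <= 2^-1 by move: xk => /andP[]; rewrite /c; lra.
    by rewrite /q /a; move: (xi - c) => e e1; rewrite ler_norml expr2; nra.
  move=> xi _; have [xk|xk] := boolP (k%:R <= xi < k%:R + 1).
    by rewrite unit_band_in // !mul1r qcos.
  by rewrite unit_band_out // !mul0r.
have I3 : Num.sqrt (2 * pi) * \int[leb]_xi (unit_band k xi * cos (th xi)) <=
    cabs (inverse_fourier (packet_fourier t k m) x).
  have ic : cintegrable leb (fun xi => cis (x * xi) * packet_fourier t k m xi).
    by apply: cintegrable_cis => //; exact: measurable_funM.
  have -> : cabs (inverse_fourier (packet_fourier t k m) x) =
      cabs (cis (- th0) * inverse_fourier (packet_fourier t k m) x).
    by rewrite cabsM cabs_cis mul1r.
  rewrite -cintegralZ //.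
  apply: le_trans (Re_le_cabs _); rewrite -RintegralZl //.
  rewrite le_eqVlt; apply/orP; left; apply/eqP; apply: eq_Rintegral => xi _.
  have -> : cis (- th0) * (cis (x * xi) * packet_fourier t k m xi) =
      (Num.sqrt (2 * pi) * unit_band k xi)%:C * cis (th xi).
    by rewrite -thE !cisD /packet_fourier; ring.
  by rewrite complex_ReM /= mul0r subr0 mulrA.
rewrite cabsM cabs_real gtr0_norm ?invr_gt0 // exprMn.
have s0 : 0 < Num.sqrt (2 * pi) :> R by rewrite sqrtr_gt0.
have lo : Num.sqrt (2 * pi) / 4 <= cabs (inverse_fourier (packet_fourier t k m) x).
  apply: le_trans I3; rewrite ler_pM2l //; exact: le_trans I2.
have : (Num.sqrt (2 * pi) / 4) ^+ 2 <= cabs (inverse_fourier (packet_fourier t k m) x) ^+ 2.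
  by apply: lerXn2r lo; rewrite nnegrE ?cabs_ge0 // divr_ge0 // ltW.
rewrite expr_div_n sqr_sqrtr ?(ltW pi2) // => lo2.
apply: (@le_trans _ _ ((2 * pi)^-1 ^+ 2 * (2 * pi / 4 ^+ 2))).
  by rewrite le_eqVlt; apply/orP; left; apply/eqP; move: (pi : R) (pi_gt0 R) => p p0; field; rewrite gt_eqF.
by rewrite ler_wpM2l ?sqr_ge0.
Qed.

End WavePackets.

(** * Failure for orthonormal systems *)

Section OrthonormalStrichartz.
Context {R : realType}.

(** The sum telescopes against [1 / sqrt (n + 1) <= 2 (sqrt (n + 1) - sqrt n)]. *)
Lemma sum_inv_sqrt_le n :
  \sum_(0 <= j < n) j.+1%:R `^ 2^-1 / j.+1%:R <= 2 * Num.sqrt n%:R :> R.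
Proof.
elim: n => [|n IH]; first by rewrite big_geq // mulr_ge0 ?sqrtr_ge0.
rewrite big_nat_recr //= (le_trans (lerD IH (lexx _))) //.
rewrite powR12_sqrt //; set b := Num.sqrt n.+1%:R; set a := Num.sqrt n%:R.
have b0 : 0 < b by rewrite sqrtr_gt0.
have a0 : 0 <= a by exact: sqrtr_ge0.
have b2 : b ^+ 2 = n.+1%:R by rewrite sqr_sqrtr.
have a2 : a ^+ 2 = n%:R by rewrite sqr_sqrtr.
rewrite -b2 expr2 invfM mulrA divff ?gt_eqF // mul1r.
have ab : b ^+ 2 = a ^+ 2 + 1 by rewrite b2 a2 natr1.
rewrite -lerBrDl -mulrBr -(ler_pM2r b0) mulVf ?gt_eqF //.
by rewrite -mulrA; have := sqr_ge0 (b - a); rewrite !expr2 in ab *; nra.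
Qed.

Lemma lorentz21_seq_indic_le n :
  (lorentz21_seq (fun j => ((j < n)%N)%:R : R) <= (2 * Num.sqrt n%:R)%:E)%E.
Proof.
apply: lime_le.
  apply: is_cvg_nneseries => j _ _; rewrite lee_fin.
  exact: divr_ge0.
apply: nearW => N; rewrite sumEFin lee_fin.
rewrite (big_cat_nat (n := minn N n)) ?geq_minl //= [X in _ + X]big1_seq ?addr0; last first.
  move=> j /andP[_]; rewrite mem_index_iota geq_min => /andP[/orP[Nj|nj] jN].
    by move: jN; rewrite ltnNge Nj.
  by rewrite ltnNge nj mulr0 mul0r.
apply: (@le_trans _ _ (\sum_(0 <= j < minn N n) j.+1%:R `^ 2^-1 / j.+1%:R)).
  rewrite big_nat_cond [leRHS]big_nat_cond; apply: ler_sum => j /andP[/andP[_ jn] _].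
  by rewrite (leq_trans jn (geq_minr _ _)) mulr1.
apply: le_trans (sum_inv_sqrt_le _) _.
by rewrite ler_wpM2l // ler_wsqrtr // ler_nat geq_minr.
Qed.

Lemma ler_sum_sub_seq (I : eqType) (s P : seq I) (w : I -> R) :
  uniq s -> uniq P -> {subset s <= P} -> (forall i, 0 <= w i) ->
  \sum_(i <- s) w i <= \sum_(i <- P) w i.
Proof.
move=> us uP sP w0.
have ps : perm_eq s [seq i <- P | i \in s].
  apply: uniq_perm => //; first exact: filter_uniq.
  move=> i; rewrite mem_filter; have [/sP ->//|//] := boolP (i \in s).
rewrite (perm_big _ ps) big_filter [leRHS](bigID (mem s)) /= lerDl.
exact: sumr_ge0.
Qed.

Lemma orthonormal_strichartz_estimate_false :
  ~ exists C : R, orthonormal_strichartz_estimate C.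
Proof.
move=> [C HC].
have pi0 := pi_gt0 R.
(* The first factor is the bound of [cabs_packet_ge]; the second is the [L^2] norm in time of the
   indicator of [[0, 1/10[]. *)
pose c0 : R := (32 * pi)^-1 * Num.sqrt 10^-1.
have c00 : 0 < c0 by rewrite mulr_gt0 ?sqrtr_gt0 ?invr_gt0 // mulr_gt0.
have [N N1] := kakeya_gain C c00.
have [P [uP sizeP ltP kakP]] := @kakeya_set R N N1.
move: sizeP ltP kakP; set M := (N ^ N)%N; set n1 := (10 * _)%N => sizeP ltP kakP gain.
pose n := size P.
(* An orthonormal system is indexed by all of [nat], so the enumeration of [P] is continued by
   packets in the bands [M + j]. These are absent from [P], whose bands lie below [M], and they get
   coefficient [0]. *)
pose idx j : nat * int := if (j < n)%N then nth (0%N, 0) P j else ((M + j)%N, 0).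
have idx_inj i j : idx i = idx j -> i = j.
  rewrite /idx; case: ltnP => iN; case: ltnP => jN.
  - by move=> /eqP; rewrite nth_uniq // => /eqP.
  - move=> e; have := ltP _ (mem_nth (0%N, 0) iN); rewrite e /=; lia.
  - move=> e; have := ltP _ (mem_nth (0%N, 0) jN); rewrite -e /=; lia.
  - by move=> []; lia.
pose u (j : nat) (t : R) := packet t (idx j).1 (idx j).2.
pose ls j : R := (j < n)%N%:R.
pose lam j : R[i] := (ls j)%:C.
pose rho (t x : R) : R[i] := (\sum_(p <- P) cabs (packet t p.1 p.2 x) ^+ 2)%:C.
have ons : orthonormal_system leb (fun j => u j 0).
  split=> [j|j k]; first by have [h _ _] := @packet_fourierL2 R 0 (idx j).1 (idx j).2; exact: h.
  rewrite inner_packet; suff -> : ((idx j).1 == (idx k).1) && ((idx j).2 == (idx k).2) = (j == k) by [].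
  rewrite -xpair_eqE -!surjective_pairing.
  by apply/eqP/eqP => [/idx_inj|->].
have sch j t : is_schrodinger t (u j 0) (u j t) by exact: packet_schrodinger.
have dec : decreasing_permutation lam ls.
  split.
  - move=> i j ij; rewrite /ls ler_nat; case: (ltnP j n) => // jn.
    by rewrite (leq_ltn_trans ij jn).
  - by move=> j; rewrite /ls.
  exists id; last first.
    by move=> j _; rewrite /lam cabs_real ger0_norm // /ls.
  have lamE k : (lam k != 0) = (ls k != 0).
    by rewrite /lam -cabs_eq0 cabs_real normr_eq0.
  split.
  - by move=> k /=; rewrite lamE.
  - by move=> k k' _ _.
  - by move=> k /=; rewrite lamE => lk; exists k.
have lor := lorentz21_seq_indic_le n.
have lor0 : (0 <= lorentz21_seq ls)%E.
  apply: nneseries_ge0 => j _ _; rewrite lee_fin.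
  by apply: divr_ge0 => //; apply: mulr_ge0; [exact: powR_ge0|exact: ler0n].
have rho_lim : \forall t \ae lebesgue_measure, \forall x \ae lebesgue_measure,
    cabs (density_partial_sum lam u t x m - rho t x) @[m --> \oo] --> (0 : R).
  apply: aeW => t; apply: aeW => x.
  apply: cvg_near_cst; exists n => // m /= nm.
  rewrite (_ : density_partial_sum _ _ _ _ _ = rho t x) ?subrr ?cabs0 //.
  rewrite /density_partial_sum -(big_mkord xpredT (fun j => lam j * (cabs (u j t x) ^+ 2)%:C)).
  rewrite (big_cat_nat (n := n)) //= [X in _ + X]big1_seq ?addr0; last first.
    move=> j /andP[_]; rewrite mem_index_iota => /andP[nj _].
    by rewrite /lam /ls ltnNge nj rmorph0 mul0r.
  rewrite /rho rmorph_sum [RHS](big_nth (0%N, 0)); apply: eq_big_nat => j /andP[_ jn].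
  by rewrite /lam /ls /u /idx jn rmorph1 mul1r.
have := HC _ u lam ls rho ons sch dec (le_lt_trans lor (ltry _)) rho_lim.
apply/negP; rewrite -ltNge.
apply: (@le_lt_trans _ _ (`|C| * (2 * Num.sqrt n1%:R))%:E).
  apply: (@le_trans _ _ (`|C|%:E * lorentz21_seq ls)%E).
    by apply: lee_wpmul2r => //; rewrite lee_fin ler_norm.
  rewrite EFinM; apply: lee_wpmul2l; rewrite ?lee_fin //.
  by apply: le_trans lor _; rewrite lee_fin ler_wpM2l // ler_wsqrtr // ler_nat.
apply: (@lt_le_trans _ _ ((32 * pi)^-1 * M%:R * Num.sqrt 10^-1)%:E).
  by rewrite lte_fin mulrAC.
apply: normL2Linfty_ge.
- by rewrite invr_ge0.
- by rewrite mulr_ge0 // invr_ge0 mulr_ge0 // ltW.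
move=> t /andP[t0 t1].
(* Measured in units of [2 pi], the centre of a packet moves with speed [(k + 1/2) / pi], so the
   Kakeya set is used at time [t / pi]. *)
have tp : 0 <= t / pi < 1.
  rewrite divr_ge0 ?(ltW pi0) //= ltr_pdivrMr // mul1r.
  by have := pi_ge2 R; lra.
have [X kakX] := kakP _ tp.
exists (2 * pi * X), (2 * pi * (X + 1)).
have pi20 : 0 < 2 * pi :> R by rewrite mulr_gt0.
split; first by rewrite ltr_pM2l // ltrDl.
move=> x /andP[xl xr]; rewrite cabs_real ger0_norm; last first.
  by apply: sumr_ge0 => p _; exact: sqr_ge0.
pose z : R := x / (2 * pi).
have zX : X <= z < X + 1.
  by rewrite ler_pdivlMr // ltr_pdivrMr // ![_ * (2 * pi)]mulrC xl xr.
have xz : x = 2 * pi * z by rewrite /z mulrC divfK // gt_eqF.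
(* For each band [k < M] this selects the packet whose tube passes through [x]: the Kakeya property
   at velocity [k + 1/2] puts it in [P]. The centre [m k + 1/2] of the cell is within [1/2] of the
   floored number, which after scaling is the distance [pi] allowed by [cabs_packet_ge]. *)
pose m k := Num.floor (z - t / pi * (k%:R + 2^-1)).
pose s := [seq (k, m k) | k <- iota 0 M].
have us : uniq s by rewrite map_inj_uniq ?iota_uniq // => k k' [].
have sP : {subset s <= P}.
  move=> p /mapP[k]; rewrite mem_iota add0n => /= kM ->.
  have kM1 : k%:R + 1 <= M%:R :> R by rewrite natr1 ler_nat.
  have kh : 0 <= (k%:R + 2^-1 : R) < M%:R.
    apply/andP; split; first exact: addr_ge0.
    by apply: lt_le_trans kM1; rewrite ltrD2l invf_lt1 // ltr1n.
  have := kakX z _ zX kh; rewrite (@truncn_def _ _ k) //.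
  by rewrite lerDl invr_ge0 ler0n -[k.+1%:R]natr1 ltrD2l invf_lt1 // ltr1n.
apply: le_trans (ler_sum_sub_seq us uP sP (fun p => sqr_ge0 _)).
apply: (@le_trans _ _ (\sum_(k <- iota 0 M) (32 * pi)^-1)).
  by rewrite big_const_seq count_predT size_iota iter_addr_0 mulr_natr.
rewrite big_map; apply: ler_sum => k _; apply: cabs_packet_ge => /=.
  by rewrite t0 ltW.
have /andP[] := floor_itv (z - t / pi * (k%:R + 2^-1)).
rewrite -/(m k) intrD; move: ((m k)%:~R : R) => mk m1 m2.
have -> : x - 2 * pi * (mk + 2^-1) - 2 * t * (k%:R + 2^-1) =
    2 * pi * (z - t / pi * (k%:R + 2^-1) - mk - 2^-1).
  rewrite xz; move: (pi : R) pi0 => p p0; field.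
  by rewrite gt_eqF.
rewrite normrM gtr0_norm // [leRHS](_ : pi = 2 * pi * 2^-1); last first.
  by rewrite mulrAC mulfV ?mul1r.
rewrite ler_pM2l // ler_norml.
move: (z - _) m1 m2 => f; lra.
Qed.

End OrthonormalStrichartz.

Theorem theorem5p3 (R : realType) :
  (~ exists C : R, velocity_average_estimate C) /\
  (~ exists C : R, orthonormal_strichartz_estimate C).
Proof.
split; first exact: velocity_average_estimate_false.
exact: orthonormal_strichartz_estimate_false.
Qed.
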